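(* For every nontrivial knot type $[K]$, $\mathrm{sps}[K]\le s[K]-2$.
   Context: The stick index $s[K]$ of a knot type $[K]$ is the smallest number of straight line segments in a closed polygonal curve in $\mathbb{R}^3$ representing $[K]$. A spherical stick diagram of $[K]$ is a closed curve on the 2-sphere formed by finitely many arcs of great circles (not entire great circles) joined end to end, whose self-intersections are transverse double points away from the arc endpoints, with crossing information at each self-intersection, representing $[K]$. For nontrivial $[K]$, $\mathrm{sps}[K]$ is the minimum number of great circle arcs in such a diagram (undefined for the unknot). *)

(* Defs.v *)
From HB Require Import structures.
From mathcomp Require Import all_boot all_order all_algebra.
From mathcomp Require Import all_classical all_reals all_analysis.
From mathcomp Require Import Rstruct Rstruct_topology.

Set Implicit Arguments.
Unset Strict Implicit.
Unset Printing Implicit Defensive.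

Import Order.TTheory GRing.Theory Num.Theory.
Local Open Scope classical_set_scope.
Local Open Scope ring_scope.

Notation RR := Rdefinitions.R.
Notation pt := 'rV[RR]_3.

Definition dotp (u v : pt) : RR := \sum_(k < 3) u ord0 k * v ord0 k.

(* A closed curve given by m pieces c 0, ..., c (m-1), each parametrized on
   [0,1], piece i ending where piece (i+1 mod m) begins. *)
Definition cyc_next (m i : nat) : nat := (i.+1 %% m)%N.

Definition curve_set (m : nat) (c : nat -> RR -> pt) : set pt :=
  [set x | exists i u, (i < m)%N /\ 0 <= u <= 1 /\ c i u = x].

Definition pw_knot (m : nat) (c : nat -> RR -> pt) : Prop :=
  (0 < m)%N /\
  (forall i, (i < m)%N -> {within `[0, 1], continuous (c i)}) /\
  (forall i, (i < m)%N -> c i 1 = c (cyc_next m i) 0) /\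
  (forall i j u w, (i < m)%N -> (j < m)%N -> 0 <= u < 1 -> 0 <= w < 1 ->
     c i u = c j w -> i = j /\ u = w).

Definition is_knot (S : set pt) : Prop :=
  exists m c, pw_knot m c /\ S = curve_set m c.

Definition ambient_isotopy (H : RR -> pt -> pt) : Prop :=
  continuous (fun p : RR * pt => H p.1 p.2) /\
  (forall x, H 0 x = x) /\
  (forall t, 0 <= t <= 1 -> exists G : pt -> pt,
      continuous (H t) /\ continuous G /\ cancel (H t) G /\ cancel G (H t)).

Definition knot_equiv (S1 S2 : set pt) : Prop :=
  exists H, ambient_isotopy H /\ H 1 @` S1 = S2.

Definition round_circle : set pt :=
  [set x | x ord0 2%:R = 0 /\ x ord0 0 ^+ 2 + x ord0 1 ^+ 2 = 1].

Definition nontrivial_knot (S : set pt) : Prop := ~ knot_equiv S round_circle.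

Definition poly_pieces (n : nat) (v : nat -> pt) : nat -> RR -> pt :=
  fun i u => (1 - u) *: v i + u *: v (cyc_next n i).

Definition stick_rep (S : set pt) (n : nat) : Prop :=
  exists v : nat -> pt, pw_knot n (poly_pieces n v) /\
    knot_equiv (curve_set n (poly_pieces n v)) S.

Definition is_stick_index (S : set pt) (n : nat) : Prop :=
  stick_rep S n /\ forall k, stick_rep S k -> (n <= k)%N.

(* arc i is the great circle arc  u |-> cos(u th_i) p_i + sin(u th_i) q_i,
   u in [0,1], where p_i, q_i are orthonormal and 0 < th_i < 2 pi
   (so the arc is not an entire great circle). *)
Definition sph_pieces (P Q : nat -> pt) (Th : nat -> RR) : nat -> RR -> pt :=
  fun i u => cos (u * Th i) *: P i + sin (u * Th i) *: Q i.

Definition sph_tangent (P Q : nat -> pt) (Th : nat -> RR) : nat -> RR -> pt :=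
  fun i u => - sin (u * Th i) *: P i + cos (u * Th i) *: Q i.

(* a closed curve on S^2 made of m great circle arcs joined end to end,
   whose self-intersections are transverse double points lying in the
   interior of the arcs (away from the arc endpoints). *)
Definition sph_stick_curve (m : nat) (P Q : nat -> pt) (Th : nat -> RR) : Prop :=
  let c := sph_pieces P Q Th in
  let T := sph_tangent P Q Th in
  (0 < m)%N /\
  (forall i, (i < m)%N ->
     [/\ dotp (P i) (P i) = 1, dotp (Q i) (Q i) = 1, dotp (P i) (Q i) = 0
       & 0 < Th i < 2 * pi]) /\
  (forall i, (i < m)%N -> c i 1 = c (cyc_next m i) 0) /\
  (forall i j u w, (i < m)%N -> (j < m)%N -> 0 <= u < 1 -> 0 <= w < 1 ->
     (i, u) <> (j, w) -> c i u = c j w ->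
     [/\ 0 < u, 0 < w,
         (forall a : RR, T j w <> a *: T i u)
       &
         forall k z, (k < m)%N -> 0 <= z < 1 -> c k z = c i u ->
           (k, z) = (i, u) \/ (k, z) = (j, w)]).

(* S (more precisely its knot type) is represented by a spherical stick
   diagram with m arcs: there is such a curve on S^2 together with crossing
   information realizing it, i.e. a positive continuous radial lift
   t |-> r(t) gamma(t) of the curve which is a knot of the type of S.  *)
Definition sps_rep (S : set pt) (m : nat) : Prop :=
  exists (P Q : nat -> pt) (Th : nat -> RR) (r : nat -> RR -> RR),
    sph_stick_curve m P Q Th /\
    (forall i, (i < m)%N -> {within `[0, 1], continuous (r i)}) /\
    (forall i u, (i < m)%N -> 0 <= u <= 1 -> 0 < r i u) /\
    pw_knot m (fun i u => r i u *: sph_pieces P Q Th i u) /\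
    knot_equiv (curve_set m (fun i u => r i u *: sph_pieces P Q Th i u)) S.

Definition is_sps (S : set pt) (m : nat) : Prop :=
  sps_rep S m /\ forall k, sps_rep S k -> (m <= k)%N.

(* Main.v *)
(* Take a polygon with s[K] edges and project it radially from a vertex 0 that
   is extreme in its convex hull. The two edges at 0 collapse to points, and the
   others, 0 being in general position, give s[K] - 2 great circle arcs
   w_0 w_1, ..., w_(N-2) w_(N-1). The planes of the first and of the last arc
   meet in a line, so these two arcs can be extended beyond w_0 and w_(N-1)
   until they meet at a point d of this line, which closes the diagram; that d
   can be chosen so that both arcs stay shorter than a full circle uses that the
   w_i lie in an open half-space. The knot is lifted from this diagram by moving
   the vertex 0 to a small multiple of d, with one additional small vertex on the
   other side of 0 when the last arc has to pass through -d first. All isotopies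
   of polygons come from one principle: a displacement of the knot with Lipschitz
   constant less than 1 extends to space by McShane's formula and gives an
   isotopy, so embedded polygons are stable and paths of embedded polygons are
   isotopies. *)

(* Crossing information is never computed: the knot stays an actual polygon that avoids the origin
   and is a radial graph over the diagram. Write A, B for w_(N-2), w_(N-1) and d = x1 w_0 + y1 w_1 =
   x2 B + y2 A, with the sign of d chosen so that y1 < 0: continued backward, the first arc reaches
   d within an angle pi of w_0. If y2 < 0, the last arc reaches d within an angle pi of B. If y2 > 0
   and x2 < 0, it passes -d and -A but still reaches d before a full turn; a straight segment cannot
   be a radial graph over an angle of pi or more, whence an additional vertex on the ray of -A. The
   obstacle is y2 > 0, x2 >= 0: d then lies on the last arc itself, and reaching it again would take
   at least a full circle. A linear form h positive on all w_i forces x1 > 0 in that case, and -d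
   works once the polygon is reversed, the two arcs exchanging roles. Nontriviality excludes
   polygons with three edges, which are isotopic to the round circle. *)
Require Import Defs.
From HB Require Import structures.
From mathcomp Require Import all_boot all_order all_algebra.
From mathcomp Require Import all_classical all_reals all_analysis.
From mathcomp Require Import Rstruct Rstruct_topology.
From mathcomp Require Import zify ring lra.

Set Implicit Arguments.
Unset Strict Implicit.
Unset Printing Implicit Defensive.

Import Order.TTheory GRing.Theory Num.Theory.
Import numFieldNormedType.Exports.
Local Open Scope classical_set_scope.
Local Open Scope ring_scope.

(* [lra] fails in the presence of hypotheses that are equations between vectors. *)
Ltac clear_vector_eqs := repeat match goal with
  H : @eq ?T _ _ |- _ => let _ := constr:(erefl : T = pt :> Type) in clear H end.
Ltac vlra := clear_vector_eqs; lra.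

(** Joins completeness with the normed structure of matrices, so that Banach's fixed point theorem
    applies to [pt]. *)
HB.instance Definition _ (R : realType) (m n : nat) := Complete.on 'M[R]_(m, n).

(** * Continuity and compactness over Stdlib's reals *)

(* Unification fails when the library's continuity lemmas are applied directly
   to [RR] and [pt]: each fact is proved for an abstract [realType] (prefix
   [gen_]) and then specialised. *)

Section generic_continuity.
Variables (R : realType) (T : topologicalType) (V : normedModType R).
Implicit Types (f g : T -> R) (u v : T -> V) (x : T).

Lemma gen_continuousDr f g x : {for x, continuous f} -> {for x, continuous g} ->
  {for x, continuous (fun t => f t + g t)}.
Proof. exact: cvgD. Qed.

Lemma gen_continuousNr f x : {for x, continuous f} ->
  {for x, continuous (fun t => - f t)}.
Proof. exact: cvgN. Qed.

Lemma gen_continuousMr f g x : {for x, continuous f} -> {for x, continuous g} ->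
  {for x, continuous (fun t => f t * g t)}.
Proof. exact: cvgM. Qed.

Lemma gen_continuousVr f x : f x != 0 -> {for x, continuous f} ->
  {for x, continuous (fun t => (f t)^-1)}.
Proof. exact: cvgV. Qed.

Lemma gen_continuous_max f g x : {for x, continuous f} -> {for x, continuous g} ->
  {for x, continuous (fun t => Num.max (f t) (g t))}.
Proof. by move=> cf cg; apply: (@continuous_max _ _ f g). Qed.

Lemma gen_continuous_min f g x : {for x, continuous f} -> {for x, continuous g} ->
  {for x, continuous (fun t => Num.min (f t) (g t))}.
Proof. by move=> cf cg; apply: (@continuous_min _ _ f g). Qed.

Lemma gen_continuousDv u v x : {for x, continuous u} -> {for x, continuous v} ->
  {for x, continuous (fun t => u t + v t)}.
Proof. exact: cvgD. Qed.

Lemma gen_continuousNv u x : {for x, continuous u} ->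
  {for x, continuous (fun t => - u t)}.
Proof. exact: cvgN. Qed.

Lemma gen_continuousZv f u x : {for x, continuous f} -> {for x, continuous u} ->
  {for x, continuous (fun t => f t *: u t)}.
Proof. exact: cvgZ. Qed.

Lemma gen_continuous_norm u x : {for x, continuous u} ->
  {for x, continuous (fun t => `|u t|)}.
Proof. exact: cvg_norm. Qed.

Lemma gen_continuous_coord m n (A : T -> 'M[R]_(m, n)) i j x :
  {for x, continuous A} -> {for x, continuous (fun t => A t i j)}.
Proof. by move=> cA; apply: (@continuous_comp _ _ _ A (fun M => M i j)); [|exact: coord_continuous]. Qed.

Lemma gen_continuous_cos f x : {for x, continuous f} -> {for x, continuous (fun t => cos (f t))}.
Proof. by move=> cf; apply: (@continuous_comp _ _ _ f cos); [|exact: continuous_cos]. Qed.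

Lemma gen_continuous_sin f x : {for x, continuous f} -> {for x, continuous (fun t => sin (f t))}.
Proof. by move=> cf; apply: (@continuous_comp _ _ _ f sin); [|exact: continuous_sin]. Qed.

End generic_continuity.

Section generic_lipschitz.
Variables (R : realType) (V W : normedModType R).

Lemma gen_lipschitz_continuous (f : V -> W) (L : R) :
  (forall x y, `|f x - f y| <= L * `|x - y|) -> continuous f.
Proof.
move=> fL x; apply/cvgrPdist_lt => e e0.
have L1 : 0 < `|L| + 1 by rewrite ltr_wpDl.
near=> y.
have h : `|x - y| < e / (`|L| + 1).
  near: y; have /cvgrPdist_lt : id @ x --> x by exact: cvg_id.
  by apply; exact: divr_gt0.
apply: (le_lt_trans (fL _ _)); apply: (@le_lt_trans _ _ ((`|L| + 1) * `|x - y|)).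
  by rewrite ler_wpM2r// (le_trans (ler_norm L))// lerDl.
by rewrite mulrC -ltr_pdivlMr.
Unshelve. all: by end_near. Qed.
End generic_lipschitz.

Lemma gen_lipschitz_fixpoint (R : realType) (V : completeNormedModType R)
  (g : V -> V) (L : R) : 0 <= L -> L < 1 ->
  (forall x y, `|g x - g y| <= L * `|x - y|) -> exists x, g x = x.
Proof.
move=> L0 L1 gL.
have [|||x _ xE] := @banach_fixed_point R V setT
     (HB.pack g (isFun.Build V V setT setT g (fun _ _ => Logic.I))).
- by exists (NngNum L0); split=> //= -[a b] _ /=.
- exact: closedT.
- by exists 0.
by exists x; exact: esym xE.
Qed.

(** The minimum over the compact square is attained; this bounds the distance between two disjoint
    edges from below without an explicit formula. *)
Lemma gen_square_positive_min (R : realType) (f : R * R -> R) :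
  continuous f -> (forall u w, 0 <= u <= 1 -> 0 <= w <= 1 -> 0 < f (u, w)) ->
  exists2 e, 0 < e & forall u w, 0 <= u <= 1 -> 0 <= w <= 1 -> e <= f (u, w).
Proof.
move=> cf f0.
have [||c|c] := @compact_EVT_min _ R f (`[0, 1] `*` `[0, 1]).
- by exists (0, 0); split => /=; rewrite in_itv/= lexx ler01.
- by apply: compact_setX; exact: segment_compact.
- exact: continuous_subspaceT.
case: c => c1 c2; rewrite inE => -[/=]; rewrite !in_itv/= => h1 h2 hm.
exists (f (c1, c2)); first exact: f0.
by move=> u w hu hw; apply: hm; rewrite inE; split=> /=; rewrite in_itv.
Qed.

Section continuity.
Variables (T : topologicalType).
Implicit Types (f g : T -> RR) (u v : T -> pt) (x : T).

Lemma continuousDr f g x : {for x, continuous f} -> {for x, continuous g} ->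
  {for x, continuous (fun t => f t + g t)}.
Proof. exact: gen_continuousDr. Qed.

Lemma continuousNr f x : {for x, continuous f} ->
  {for x, continuous (fun t => - f t)}.
Proof. exact: gen_continuousNr. Qed.

Lemma continuousMr f g x : {for x, continuous f} -> {for x, continuous g} ->
  {for x, continuous (fun t => f t * g t)}.
Proof. exact: gen_continuousMr. Qed.

Lemma continuousVr f x : f x != 0 -> {for x, continuous f} ->
  {for x, continuous (fun t => (f t)^-1)}.
Proof. exact: gen_continuousVr. Qed.

Lemma continuous_maxr f g x : {for x, continuous f} -> {for x, continuous g} ->
  {for x, continuous (fun t => Num.max (f t) (g t))}.
Proof. exact: gen_continuous_max. Qed.

Lemma continuous_minr f g x : {for x, continuous f} -> {for x, continuous g} ->
  {for x, continuous (fun t => Num.min (f t) (g t))}.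
Proof. exact: gen_continuous_min. Qed.

Lemma continuousDv u v x : {for x, continuous u} -> {for x, continuous v} ->
  {for x, continuous (fun t => u t + v t)}.
Proof. exact: gen_continuousDv. Qed.

Lemma continuousNv u x : {for x, continuous u} ->
  {for x, continuous (fun t => - u t)}.
Proof. exact: gen_continuousNv. Qed.

Lemma continuousZv f u x : {for x, continuous f} -> {for x, continuous u} ->
  {for x, continuous (fun t => f t *: u t)}.
Proof. exact: gen_continuousZv. Qed.

Lemma continuous_normv u x : {for x, continuous u} ->
  {for x, continuous (fun t => `|u t|)}.
Proof. exact: gen_continuous_norm. Qed.

Lemma continuous_coord u j x : {for x, continuous u} ->
  {for x, continuous (fun t => u t ord0 j)}.
Proof. exact: gen_continuous_coord. Qed.

Lemma continuous_cosr f x : {for x, continuous f} -> {for x, continuous (fun t => cos (f t))}.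
Proof. exact: gen_continuous_cos. Qed.

Lemma continuous_sinr f x : {for x, continuous f} -> {for x, continuous (fun t => sin (f t))}.
Proof. exact: gen_continuous_sin. Qed.

Lemma continuous_pair (U V : topologicalType) (f : T -> U) (g : T -> V) x :
  {for x, continuous f} -> {for x, continuous g} ->
  {for x, continuous (fun t => (f t, g t))}.
Proof.
by move=> fx gx; apply: (@cvg_pair _ _ _ _ (nbhs (f x)) (nbhs (g x))).
Qed.
End continuity.

Lemma lipschitz_continuous (f : pt -> pt) (L : RR) :
  (forall x y, `|f x - f y| <= L * `|x - y|) -> continuous f.
Proof. exact: gen_lipschitz_continuous. Qed.

Lemma lipschitz_fixpoint (g : pt -> pt) (L : RR) : 0 <= L -> L < 1 ->
  (forall x y, `|g x - g y| <= L * `|x - y|) -> exists x, g x = x.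
Proof. exact: gen_lipschitz_fixpoint. Qed.

Lemma square_positive_min (f : RR * RR -> RR) :
  continuous f -> (forall u w, 0 <= u <= 1 -> 0 <= w <= 1 -> 0 < f (u, w)) ->
  exists2 e, 0 < e & forall u w, 0 <= u <= 1 -> 0 <= w <= 1 -> e <= f (u, w).
Proof. exact: gen_square_positive_min. Qed.

(** * Isotopies from Lipschitz displacements *)

Lemma knot_equiv_refl (A : set pt) : knot_equiv A A.
Proof.
exists (fun _ x => x); split; last by rewrite image_id.
split; first by move=> p; exact: cvg_snd.
split=> // t _; exists id; split; last split=> //; move=> x; exact: cvg_id.
Qed.

Lemma knot_equiv_trans (A B C : set pt) :
  knot_equiv A B -> knot_equiv B C -> knot_equiv A C.
Proof.
move=> [H [[cH [H0 Hh]] HAB]] [K [[cK [K0 Kh]] KBC]].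
exists (fun t x => K t (H t x)); split; last first.
  by rewrite -KBC -HAB; rewrite image_comp.
split.
  move=> p.
  apply: (@continuous_comp _ _ _ (fun p : RR * pt => (p.1, H p.1 p.2))
    (fun p : RR * pt => K p.1 p.2)); last exact: cK.
  by apply: continuous_pair; [exact: cvg_fst|exact: cH].
split; first by move=> x; rewrite H0 K0.
move=> t t01; have [G [cHt [cG [HG GH]]]] := Hh t t01.
have [G' [cKt [cG' [KG GK]]]] := Kh t t01.
exists (G \o G'); split; first by move=> x; apply: continuous_comp; [exact: cHt|exact: cKt].
split; first by move=> x; apply: continuous_comp; [exact: cG'|exact: cG].
by split=> x /=; rewrite ?KG ?HG ?GH ?GK.
Qed.

Lemma knot_equiv_sym (A B : set pt) : knot_equiv A B -> knot_equiv B A.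
Proof.
move=> [H [[cH [H0 Hh]] HAB]].
have [|G [cH1 [cG [HG GH]]]] := Hh 1; first by rewrite ler01 lexx.
exists (fun t x => H (1 - t) (G x)); split; last first.
  rewrite -HAB image_comp -[RHS]image_id; apply: eq_imagel => x _ /=.
  by rewrite subrr H0 HG.
split.
  move=> p.
  apply: (@continuous_comp _ _ _ (fun p : RR * pt => (1 - p.1, G p.2))
    (fun p : RR * pt => H p.1 p.2)); last exact: cH.
  apply: continuous_pair.
    apply: (@continuousDr (RR * pt)%type); first exact: cvg_cst.
    by apply: (@continuousNr (RR * pt)%type); exact: cvg_fst.
  by apply: (@continuous_comp _ _ _ snd G); [exact: cvg_snd|exact: cG].
split; first by move=> x; rewrite subr0 GH.
move=> t t01; have [|G' [cHt [cG' [HG' GH']]]] := Hh (1 - t); first by lra.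
exists (H 1 \o G'); split; first by move=> x; apply: continuous_comp; [exact: cG|exact: cHt].
split; first by move=> x; apply: continuous_comp; [exact: cG'|exact: cH1].
by split=> x /=; rewrite ?HG' ?GH ?HG ?GH'.
Qed.

(** Since L < 1, each map x + t f(x) shrinks distances at most by the factor 1 - L, which gives
    injectivity and a Lipschitz inverse; a preimage of y is a fixed point of the contraction x |-> y
    - t f(x). *)
Lemma lipschitz_isotopy (f : pt -> pt) (L : RR) :
  0 <= L -> L < 1 -> (forall x y, `|f x - f y| <= L * `|x - y|) ->
  ambient_isotopy (fun t x => x + t *: f x).
Proof.
move=> L0 L1 fL; have cf := lipschitz_continuous fL.
split.
  move=> p; apply: (@continuousDv (RR * pt)%type); first exact: cvg_snd.
  apply: (@continuousZv (RR * pt)%type); first exact: cvg_fst.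
  by apply: (@continuous_comp _ _ _ snd f); [exact: cvg_snd|exact: cf].
split; first by move=> x; rewrite scale0r addr0.
move=> t /andP[t0 t1].
pose h x := x + t *: f x.
have tfL x y : `|t *: f x - t *: f y| <= L * `|x - y|.
  rewrite -scalerBr normrZ ger0_norm// (le_trans _ (fL x y))//.
  by rewrite ler_piMl.
have hinj x y : (1 - L) * `|x - y| <= `|h x - h y|.
  have := tfL x y.
  have -> : h x - h y = (x - y) + (t *: f x - t *: f y) by rewrite /h opprD addrACA.
  have := lerB_normD (x - y) (t *: f x - t *: f y); lra.
have hsurj y : exists x, h x = y.
  pose g (x : pt) := y - t *: f x.
  have [||a b|x xE] := @lipschitz_fixpoint g L => //.
    by rewrite /g opprB addrC subrKA distrC; exact: le_trans (tfL _ _).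
  by exists x; rewrite /h -{1}xE /g subrK.
have [G hG] := choice hsurj.
exists G; split.
  by move=> x; apply: (@continuousDv pt id); [exact: cvg_id|];
    apply: (@continuousZv pt (fun=> t) f); [exact: cst_continuous|exact: cf].
split.
  apply: (@lipschitz_continuous G (1 - L)^-1) => x y.
  by rewrite ler_pdivlMl ?subr_gt0//; have := hinj (G x) (G y); rewrite !hG.
split=> x; last exact: hG.
apply/eqP; rewrite -subr_eq0 -normr_le0 -(@pmulr_rle0 _ (1 - L)) ?subr_gt0//.
by have := hinj (G (h x)) x; rewrite hG subrr normr0.
Qed.

(** * Lipschitz extension from a subset *)

Lemma coord_le_norm (x : pt) (k : 'I_3) : `|x ord0 k| <= `|x|.
Proof.
rewrite [leRHS]/Num.Def.normr/= mx_normrE.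
exact: (le_bigmax _ (fun i : 'I_1 * 'I_3 => `|x i.1 i.2|) (ord0, k)).
Qed.

Lemma norm_le_coord (x : pt) (e : RR) :
  0 <= e -> (forall k, `|x ord0 k| <= e) -> `|x| <= e.
Proof.
move=> e0 xe; rewrite [leLHS]/Num.Def.normr/= mx_normrE.
by apply: bigmax_le => // -[i j] _ /=; rewrite (ord1 i).
Qed.

(** The extension is the infimum over a of g(a) + L |x - c(a)|; the base point [i0] shows that these
    values are bounded below. *)
Lemma mcshane (I : Type) (D : set I) (c : I -> pt) (g : I -> RR) (L : RR) :
  0 <= L -> D !=set0 ->
  (forall a b, D a -> D b -> `|g a - g b| <= L * `|c a - c b|) ->
  exists f : pt -> RR, (forall x y, `|f x - f y| <= L * `|x - y|) /\
    forall a, D a -> f (c a) = g a.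
Proof.
move=> L0 [i0 Di0] gL.
pose E x := [set g a + L * `|x - c a| | a in D].
have E0 x : E x !=set0 by exists (g i0 + L * `|x - c i0|), i0.
have Elb x : has_lbound (E x).
  exists (g i0 - L * `|x - c i0|) => _ [a Da <-].
  have := gL i0 a Di0 Da; rewrite ler_norml => /andP[_ h].
  have := ler_distD x (c i0) (c a); rewrite (distrC (c i0) x).
  move=> /(ler_wpM2l L0); lra.
pose f x := inf (E x).
have fle x y : f x - f y <= L * `|x - y|.
  rewrite lerBlDr -lerBlDl; apply: lb_le_inf; first exact: E0.
  move=> _ [a Da <-].
  have : f x <= g a + L * `|x - c a| by apply: ge_inf; [exact: Elb|exists a].
  have := ler_distD y x (c a); move=> /(ler_wpM2l L0); lra.
exists f; split.
  move=> x y; rewrite ler_norml fle andbT.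
  by have := fle y x; rewrite distrC; lra.
move=> a Da; apply/eqP; rewrite eq_le; apply/andP; split.
  rewrite -[leRHS]addr0 -(mulr0 L) -(normr0 pt) -(subrr (c a)).
  by apply: ge_inf; [exact: Elb|exists a].
apply: lb_le_inf; first exact: E0.
move=> _ [b Db <-]; have := gL a b Da Db; rewrite ler_norml; lra.
Qed.

(* The McShane extension, which keeps the Lipschitz constant L for the sup norm,
   turns the displacement c a |-> c' a - c a into a vector field on the whole
   space. *)
Lemma lipschitz_equiv (I : Type) (D : set I) (c c' : I -> pt) (L : RR) :
  0 <= L -> L < 1 ->
  (forall a b, D a -> D b ->
     `|(c' a - c a) - (c' b - c b)| <= L * `|c a - c b|) ->
  knot_equiv (c @` D) (c' @` D).
Proof.
move=> L0 L1 cL.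
have [->|/set0P D0] := eqVneq D set0.
  by rewrite !image_set0; exact: knot_equiv_refl.
have : forall k : 'I_3, exists f : pt -> RR,
    (forall x y, `|f x - f y| <= L * `|x - y|) /\
    forall a, D a -> f (c a) = (c' a - c a) ord0 k.
  move=> k; apply: mcshane => // a b Da Db.
  apply: le_trans (cL a b Da Db).
  have -> : (c' a - c a) ord0 k - (c' b - c b) ord0 k
      = ((c' a - c a) - (c' b - c b)) ord0 k by rewrite !mxE.
  exact: coord_le_norm.
move=> /choice[F FP].
pose f x : pt := \row_k F k x.
exists (fun t x => x + t *: f x); split.
  apply: (lipschitz_isotopy L0 L1) => x y.
  apply: norm_le_coord; first exact: mulr_ge0.
  by move=> k; rewrite !mxE; have [+ _] := FP k; exact.
rewrite image_comp; apply: eq_imagel => a Da /=.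
rewrite scale1r; apply/rowP => k; rewrite !mxE.
by have [_ ->] := FP k => //; rewrite !mxE addrC subrK.
Qed.

(** A constant displacement has Lipschitz constant 0. *)
Lemma knot_equiv_translate (A : set pt) (b : pt) :
  knot_equiv A [set x + b | x in A].
Proof.
rewrite -[X in knot_equiv X _]image_id.
apply: (@lipschitz_equiv _ _ _ _ 0) => // x y _ _.
by rewrite mul0r [x + b]addrC [y + b]addrC !addrK subrr normr0.
Qed.

(** * Stability of embedded polygons *)

Definition poly_emb (n : nat) (v : nat -> pt) := pw_knot n (poly_pieces n v).
Definition poly_set (n : nat) (v : nat -> pt) := curve_set n (poly_pieces n v).

Lemma cyc_nextE n i : (i < n)%N ->
  cyc_next n i = if i.+1 == n then 0%N else i.+1.
Proof.
rewrite /cyc_next; case: eqVneq => [->|ne] lt; first by rewrite modnn.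
by rewrite modn_small// ltn_neqAle ne.
Qed.

Lemma cyc_next_lt n i : (0 < n)%N -> (cyc_next n i < n)%N.
Proof. exact: ltn_pmod. Qed.

Lemma cyc_next_inj n i j : (i < n)%N -> (j < n)%N ->
  cyc_next n i = cyc_next n j -> i = j.
Proof. by move=> hi hj; rewrite !cyc_nextE//; do 2 case: eqP; lia. Qed.

Lemma poly_pieces0 n v i : poly_pieces n v i 0 = v i.
Proof. by rewrite /poly_pieces subr0 scale1r scale0r addr0. Qed.

Lemma poly_pieces1 n v i : poly_pieces n v i 1 = v (cyc_next n i).
Proof. by rewrite /poly_pieces subrr scale1r scale0r add0r. Qed.

Lemma continuous_poly_pieces n v i : continuous (poly_pieces n v i).
Proof.
move=> u; apply: (@continuousDv RR).
  apply: (@continuousZv RR (fun u => 1 - u) (fun=> v i)); last exact: cst_continuous.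
  apply: (@continuousDr RR (fun=> 1)); first exact: cst_continuous.
  exact: (@continuousNr RR id).
by apply: (@continuousZv RR id (fun=> v _)); last exact: cst_continuous.
Qed.

Lemma poly_embE n v : (0 < n)%N ->
  (forall i j u w, (i < n)%N -> (j < n)%N -> 0 <= u < 1 -> 0 <= w < 1 ->
     poly_pieces n v i u = poly_pieces n v j w -> i = j /\ u = w) ->
  poly_emb n v.
Proof.
move=> n0 inj; split=> //; split; last split=> //.
- by move=> i _; apply: continuous_subspaceT; exact: continuous_poly_pieces.
- by move=> i hi; rewrite poly_pieces0 poly_pieces1.
Qed.

(** Embeddedness is stated on half-open parameter intervals. The end of an edge is the start of the
    next one, so closed intervals add only the coincidences at shared vertices. *)
Lemma poly_emb_closed n v i j u w : poly_emb n v -> (i < n)%N -> (j < n)%N ->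
  0 <= u <= 1 -> 0 <= w <= 1 -> poly_pieces n v i u = poly_pieces n v j w ->
  [\/ i = j /\ u = w, [/\ j = cyc_next n i, u = 1 & w = 0]
    | [/\ i = cyc_next n j, w = 1 & u = 0]].
Proof.
move=> [n0 [_ [_ inj]]] hi hj /andP[u0 u1] /andP[w0 w1] e.
have L := cyc_next_lt.
have [u1'|u1'] := ltrP u 1; have [w1'|w1'] := ltrP w 1.
- by constructor 1; apply: inj e => //; rewrite ?u0 ?w0.
- have wE : w = 1 by lra.
  move: e; rewrite wE poly_pieces1 -(poly_pieces0 n) => e; constructor 3.
  have [] := inj _ _ _ _ hi (L _ _ n0) _ _ e; rewrite ?u0 ?lexx ?ltr01//.
- have uE : u = 1 by lra.
  move: e; rewrite uE poly_pieces1 -(poly_pieces0 n) => e; constructor 2.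
  have [] := inj _ _ _ _ (L _ _ n0) hj _ _ e; rewrite ?w0 ?lexx ?ltr01//.
- have uE : u = 1 by lra.
  have wE : w = 1 by lra.
  move: e; rewrite uE wE !poly_pieces1 -!(poly_pieces0 n) => e; constructor 1; split=> //.
  by have [||/cyc_next_inj -> //] := inj _ _ _ _ (L _ _ n0) (L _ _ n0) _ _ e;
    rewrite ?lexx ?ltr01.
Qed.

Lemma finite_uniform_bound n (P : nat -> RR -> Prop) :
  (forall i K K', P i K -> K <= K' -> P i K') ->
  (forall i, (i < n)%N -> exists2 K, 0 <= K & P i K) ->
  exists2 K, 0 <= K & forall i, (i < n)%N -> P i K.
Proof.
move=> mono; elim: n => [|n IH] h; first by exists 0.
have [K K0 PK] : exists2 K, 0 <= K & forall i, (i < n)%N -> P i K.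
  by apply: IH => i hi; apply: h; lia.
have [K' K'0 PK'] := h n (leqnn _).
exists (K + K'); first exact: addr_ge0.
move=> i; rewrite ltnS leq_eqVlt => /orP[/eqP->|/PK Pi].
  by apply: mono PK' _; rewrite lerDr.
by apply: mono Pi _; rewrite lerDl.
Qed.

Lemma norm_lerp_le (a b : pt) (e t : RR) : 0 <= t <= 1 ->
  `|a| <= e -> `|b| <= e -> `|(1 - t) *: a + t *: b| <= e.
Proof.
move=> /andP[t0 t1] ae be; apply: (le_trans (ler_normD _ _)).
rewrite !normrZ (ger0_norm t0) ger0_norm ?subr_ge0//.
have := ler_wpM2l t0 be.
have /ler_wpM2l : 0 <= 1 - t by rewrite subr_ge0.
by move=> /(_ _ _ ae); lra.
Qed.

(** Both sides are homogeneous in (a, b), so compactness of the segment a + b = 1 suffices. For two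
    edges leaving a common vertex, the distance of their points is at least proportional to the sum
    of their parameters. *)
Lemma adjacent_sep (p q : pt) :
  (forall a b, 0 <= a <= 1 -> 0 <= b <= 1 -> a + b = 1 -> a *: p != b *: q) ->
  exists2 e, 0 < e &
    forall a b, 0 <= a -> 0 <= b -> e * (a + b) <= `|a *: p - b *: q|.
Proof.
move=> ne.
have [||e e0 he] := @square_positive_min (fun x => `|x.1 *: p - (1 - x.1) *: q|).
- move=> x; apply: (@continuous_normv (RR * RR)%type).
  apply: (@continuousDv (RR * RR)%type).
    apply: (@continuousZv (RR * RR)%type fst (fun=> p)); last exact: cst_continuous.
    exact: cvg_fst.
  apply: (@continuousNv (RR * RR)%type).
  apply: (@continuousZv (RR * RR)%type _ (fun=> q)); last exact: cst_continuous.
  apply: (@continuousDr (RR * RR)%type (fun=> 1)); first exact: cst_continuous.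
  by apply: (@continuousNr (RR * RR)%type); exact: cvg_fst.
- move=> u w /= /andP[u0 u1] _; rewrite normr_gt0 subr_eq0.
  by apply: ne; lra.
exists e => // a b a0 b0.
have [ab|ab] := ltrP 0 (a + b); last first.
  have -> : a = 0 by lra.
  have -> : b = 0 by lra.
  by rewrite addr0 mulr0.
have := he (a / (a + b)) 0; rewrite lexx ler01 /=.
have h1 : 0 <= a / (a + b) by rewrite divr_ge0// ltW.
have h2 : a / (a + b) <= 1 by rewrite ler_pdivrMr// mul1r lerDl.
rewrite h1 h2 => /(_ isT isT).
rewrite -(ler_pM2r ab) => /le_trans; apply.
rewrite -[X in _ * X]ger0_norm; last exact: ltW.
rewrite mulrC -normrZ scalerBr !scalerA.
have -> : (a + b) * (a / (a + b)) = a by field; exact: lt0r_neq0.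
by have -> : (a + b) * (1 - a / (a + b)) = b by field; exact: lt0r_neq0.
Qed.

(* Linear in the displacement d of the vertices, so that a small displacement has
   a small Lipschitz constant along the polygon. *)
Lemma poly_bilipschitz n v : poly_emb n v ->
  exists2 K, 0 <= K &
    forall (d : nat -> pt) e, (forall i, (i < n)%N -> `|d i| <= e) ->
    forall i j u w, (i < n)%N -> (j < n)%N -> 0 <= u <= 1 -> 0 <= w <= 1 ->
    `|poly_pieces n d i u - poly_pieces n d j w| <=
      K * e * `|poly_pieces n v i u - poly_pieces n v j w|.
Proof.
move=> emb; have n0 := emb.1.
have L i := @cyc_next_lt n i n0.
have dle (d : nat -> pt) (e : RR) : (forall i, (i < n)%N -> `|d i| <= e) -> 0 <= e.
  by move=> /(_ 0%N n0); exact: le_trans (normr_ge0 _).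
pose Q i j K := forall (d : nat -> pt) e, (forall i, (i < n)%N -> `|d i| <= e) ->
  forall u w, 0 <= u <= 1 -> 0 <= w <= 1 ->
   `|poly_pieces n d i u - poly_pieces n d j w| <=
      K * e * `|poly_pieces n v i u - poly_pieces n v j w|.
have Qmono i j K K' : Q i j K -> K <= K' -> Q i j K'.
  move=> h le d e hd u w hu hw; apply: (le_trans (h d e hd u w hu hw)).
  by apply: ler_wpM2r => //; apply: ler_wpM2r => //; exact: dle hd.
suff QP i j : (i < n)%N -> (j < n)%N -> exists2 K, 0 <= K & Q i j K.
  have [|i hi|K K0 hK] := @finite_uniform_bound n (fun i K => forall j, (j < n)%N -> Q i j K).
  - by move=> i K K' h le j hj; apply: Qmono le; exact: h.
  - apply: finite_uniform_bound => [j K K'|j hj]; [exact: Qmono|exact: QP].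
  by exists K => // d e hd i j u w hi hj hu hw; exact: hK.
have Qsym a b K : Q a b K -> Q b a K.
  by move=> h d e hd u w hu hw; rewrite distrC (distrC (poly_pieces n v b u)); exact: h.
(* Near the shared vertex the distance tends to 0, so no constant bounds it from below; both sides
   are compared with [1 - u + w] instead. *)
have Qadj a : (a < n)%N -> a != cyc_next n a -> exists2 K, 0 <= K & Q a (cyc_next n a) K.
  move=> ha ne; set b := cyc_next n a.
  have diffE (x : nat -> pt) u w : poly_pieces n x a u - poly_pieces n x b w =
      (1 - u) *: (x a - x b) - w *: (x (cyc_next n b) - x b).
    by rewrite /poly_pieces -/b; apply/rowP => k; rewrite !mxE; ring.
  have [|c c0 hc] := @adjacent_sep (v a - v b) (v (cyc_next n b) - v b).
    move=> s t s01 t01 st; rewrite -subr_eq0.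
    have -> : s *: (v a - v b) = (1 - (1 - s)) *: (v a - v b) by rewrite subKr.
    rewrite -diffE subr_eq0; apply/eqP => /poly_emb_closed.
    move=> []//; rewrite ?L//; first by lra.
    - by move=> [ab _]; move: ne; rewrite -/b -ab eqxx.
    - by move=> [_ ? ?]; lra.
    - move=> [_ ? ?]; lra.
  exists (2 / c); first by rewrite divr_ge0// ltW.
  move=> d e hd u w /andP[u0 u1] /andP[w0 w1].
  have e0 := dle _ _ hd.
  rewrite !diffE; have := hc (1 - u) w; rewrite subr_ge0 => /(_ u1 w0) h.
  apply: (@le_trans _ _ (2 * e * (1 - u + w))).
    apply: (le_trans (ler_normB _ _)); rewrite !normrZ (ger0_norm w0) ger0_norm ?subr_ge0//.
    have h1 : `|d a - d b| <= 2 * e.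
      by apply: (le_trans (ler_normB _ _)); have := hd _ ha; have := hd _ (L a); rewrite -/b; lra.
    have h2 : `|d (cyc_next n b) - d b| <= 2 * e.
      by apply: (le_trans (ler_normB _ _)); have := hd _ (L b); have := hd _ (L a); rewrite -/b; lra.
    rewrite mulrDr; apply: lerD; rewrite mulrC; apply: ler_wpM2r => //; lra.
  have e2 : 0 <= 2 * e by lra.
  have : 1 - u + w <= c^-1 * `|(1 - u) *: (v a - v b) - w *: (v (cyc_next n b) - v b)|.
    by rewrite ler_pdivlMl.
  by move=> /(ler_wpM2l e2) /le_trans; apply; rewrite le_eqVlt; apply/orP; left; apply/eqP; ring.
move=> hi hj.
have [<-{j hj}|ij] := eqVneq i j.
  have vne : 0 < `|v (cyc_next n i) - v i|.
    rewrite normr_gt0 subr_eq0; apply/eqP => E.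
    have e2 : poly_pieces n v i 0 = poly_pieces n v i (2^-1).
      by rewrite poly_pieces0 /poly_pieces E -scalerDl subrK scale1r.
    have [||[_ ?]|[_ ? _]|[_ ? _]] := poly_emb_closed emb hi hi _ _ e2; vlra.
  exists (2 / `|v (cyc_next n i) - v i|); first by rewrite divr_ge0.
  move=> d e hd u w _ _.
  have diffE (x : nat -> pt) : poly_pieces n x i u - poly_pieces n x i w =
      (u - w) *: (x (cyc_next n i) - x i).
    by rewrite /poly_pieces; apply/rowP => k; rewrite !mxE; ring.
  rewrite !diffE !normrZ [leLHS]mulrC [leRHS]mulrCA [leRHS]mulrC.
  apply: ler_wpM2r => //; rewrite mulrAC divfK ?lt0r_neq0//.
  by apply: (le_trans (ler_normB _ _)); have := hd _ hi; have := hd _ (L i); lra.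
have [jE|jE] := eqVneq j (cyc_next n i).
  by rewrite jE in ij *; exact: Qadj.
have [iE|iE] := eqVneq i (cyc_next n j).
  have [|K K0 QK] := Qadj j hj; first by rewrite -iE eq_sym.
  by exists K => //; apply: Qsym; rewrite {1}iE.
(* Disjoint edges keep a positive distance [c], while the displacements differ by at most
   [2 * e]. *)
have [||c c0 hc] := @square_positive_min (fun x => `|poly_pieces n v i x.1 - poly_pieces n v j x.2|).
- move=> x; apply: (@continuous_normv (RR * RR)%type).
  apply: (@continuousDv (RR * RR)%type (fun x => poly_pieces n v i x.1)).
    by apply: (@continuous_comp _ _ _ fst); [exact: cvg_fst|exact: continuous_poly_pieces].
  apply: (@continuousNv (RR * RR)%type).
  by apply: (@continuous_comp _ _ _ snd); [exact: cvg_snd|exact: continuous_poly_pieces].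
- move=> u w hu hw /=; rewrite normr_gt0 subr_eq0; apply/eqP => /poly_emb_closed.
  move=> /(_ emb hi hj hu hw) [[E _]|[E _ _]|[E _ _]].
  + by rewrite E eqxx in ij.
  + by rewrite E eqxx in jE.
  + by rewrite E eqxx in iE.
exists (2 / c); first by rewrite divr_ge0// ltW.
move=> d e hd u w hu hw; have e0 := dle _ _ hd.
apply: (@le_trans _ _ (2 * e)).
  apply: (le_trans (ler_normB _ _)).
  have := norm_lerp_le hu (hd _ hi) (hd _ (L i)).
  have := norm_lerp_le hw (hd _ hj) (hd _ (L j)).
  by rewrite -!/(poly_pieces _ _ _ _); lra.
have e2 : 0 <= 2 * e by lra.
have : 1 <= c^-1 * `|poly_pieces n v i u - poly_pieces n v j w|.
  by rewrite ler_pdivlMl// mulr1; exact: hc.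
by move=> /(ler_wpM2l e2); rewrite mulr1 => /le_trans; apply; rewrite le_eqVlt; apply/orP; left; apply/eqP; ring.
Qed.

Lemma poly_setE n v : poly_set n v =
  (fun p : nat * RR => poly_pieces n v p.1 p.2) @` [set p | (p.1 < n)%N /\ 0 <= p.2 <= 1].
Proof.
apply/seteqP; split=> [x [i [u [hi [hu <-]]]]|x [[i u] [hi hu] <-]]; first by exists (i, u).
by exists i, u.
Qed.

Lemma poly_piecesB n v v' i u :
  poly_pieces n (fun i => v' i - v i) i u = poly_pieces n v' i u - poly_pieces n v i u.
Proof. by rewrite /poly_pieces; apply/rowP => k; rewrite !mxE; ring. Qed.

(** The chosen radius makes the displacement along the polygon Lipschitz with constant 1/2: it can
    neither identify two points of the polygon nor fail to extend to an isotopy. *)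
Lemma poly_stable n v : poly_emb n v ->
  exists2 e, 0 < e & forall v', (forall i, (i < n)%N -> `|v' i - v i| < e) ->
    poly_emb n v' /\ knot_equiv (poly_set n v) (poly_set n v').
Proof.
move=> emb; have [K K0 hK] := poly_bilipschitz emb.
have K1 : 0 < 2 * (K + 1) by lra.
exists (2 * (K + 1))^-1; first by rewrite invr_gt0.
move=> v' hv'.
have L i j u w : (i < n)%N -> (j < n)%N -> 0 <= u <= 1 -> 0 <= w <= 1 ->
  `|(poly_pieces n v' i u - poly_pieces n v i u) - (poly_pieces n v' j w - poly_pieces n v j w)|
    <= 2^-1 * `|poly_pieces n v i u - poly_pieces n v j w|.
  move=> hi hj hu hw; rewrite -!poly_piecesB.
  have hd k : (k < n)%N -> `|v' k - v k| <= (2 * (K + 1))^-1 by move=> /hv'/ltW.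
  apply: (le_trans (hK _ _ hd i j u w hi hj hu hw)); apply: ler_wpM2r => //.
  by rewrite ler_pdivrMr// mulrA mulVf// mul1r; lra.
split; last first.
  rewrite !poly_setE; apply: (@lipschitz_equiv _ _ _ _ 2^-1); [lra|lra|].
  by move=> [i u] [j w] [hi hu] [hj hw]; exact: L.
apply: poly_embE; first exact: emb.1.
move=> i j u w hi hj hu hw E.
apply: emb.2.2.2 => //; apply/eqP; rewrite -subr_eq0 -normr_le0.
have [/andP[u0 u1] /andP[w0 w1]] := (hu, hw).
have := L i j u w hi hj; rewrite u0 w0 (ltW u1) (ltW w1) => /(_ isT isT).
rewrite E; set p := poly_pieces n v i u; set q := poly_pieces n v j w.
have -> : poly_pieces n v' j w - p - (poly_pieces n v' j w - q) = - (p - q).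
  by apply/rowP => k; rewrite !mxE; ring.
by rewrite normrN; vlra.
Qed.

(** Connectedness of [0, 1], through the supremum of the parameters where [P] holds. The local
    equivalence is used backward to bring [P] to the supremum from a nearby parameter, and forward
    to go past it. *)
Lemma segment_locally_constant (P : RR -> Prop) : P 0 ->
  (forall s, 0 <= s <= 1 -> exists2 d, 0 < d &
     forall t, 0 <= t <= 1 -> `|t - s| < d -> P s <-> P t) ->
  P 1.
Proof.
move=> P0 Ploc.
pose A := [set s : RR | 0 <= s <= 1 /\ P s].
have hA : has_sup A.
  split; first by exists 0; split=> //; rewrite lexx ler01.
  by exists 1 => s [/andP[]].
have A0 : A 0 by split=> //; rewrite lexx ler01.
have s01 : 0 <= sup A <= 1.
  apply/andP; split; first exact: (sup_upper_bound hA).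
  by apply: ge_sup; [exists 0|move=> s [/andP[]]].
have [d d0 hd] := Ploc _ s01.
have [t At ht] := sup_adherent d0 hA.
have tle := sup_upper_bound hA At.
case: At => t01 Pt.
have Ps : P (sup A) by apply/(hd t) => //; rewrite ltr_norml; lra.
have [<-//|s1] := eqVneq (sup A) 1.
have s1' : sup A < 1 by rewrite lt_neqAle s1; case/andP: s01.
pose t' := Num.min 1 (sup A + d / 2).
have t'1 : sup A < t' by rewrite lt_min s1' ltrDl divr_gt0.
have t'2 : t' <= 1 by rewrite ge_min lexx.
have t'3 : t' <= sup A + d / 2 by rewrite ge_min lexx orbT.
have : A t'.
  split; first by lra.
  by apply/(hd t'); rewrite ?ltr_norml//; lra.
by move/(sup_upper_bound hA); lra.
Qed.

(** Finitely many vertices move at bounded speed, so [poly_stable] makes the knot type locally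
    constant along the path. *)
Lemma poly_path n v v' : (forall s, 0 <= s <= 1 ->
    poly_emb n (fun i => (1 - s) *: v i + s *: v' i)) ->
  knot_equiv (poly_set n v) (poly_set n v').
Proof.
move=> emb; pose V s i := (1 - s) *: v i + s *: v' i.
have -> : v = V 0 by apply/funext => i; rewrite /V subr0 scale1r scale0r addr0.
have -> : v' = V 1 by apply/funext => i; rewrite /V subrr scale1r scale0r add0r.
apply: (@segment_locally_constant (fun s => knot_equiv (poly_set n (V 0)) (poly_set n (V s)))).
  exact: knot_equiv_refl.
move=> s s01; have [e e0 he] := poly_stable (emb s s01).
have [||M M0 hM] := @finite_uniform_bound n (fun i M => `|v' i - v i| <= M).
- by move=> i K K'; exact: le_trans.
- by move=> i _; exists `|v' i - v i|.
have M1 : 0 < M + 1 by lra.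
exists (e / (M + 1)); first exact: divr_gt0.
move=> t t01 ts.
have [|_ E] := he (V t).
  move=> i hi.
  have -> : V t i - V s i = (t - s) *: (v' i - v i).
    by rewrite /V; apply/rowP => k; rewrite !mxE; ring.
  rewrite normrZ.
  move: ts; rewrite ltr_pdivlMr//; apply: le_lt_trans.
  by apply: ler_wpM2l => //; have := hM i hi; lra.
split=> h; apply: knot_equiv_trans h _; first exact: E.
exact: knot_equiv_sym.
Qed.

Lemma pw_knot_ext m (c c' : nat -> RR -> pt) :
  (forall i, (i < m)%N -> c i = c' i) -> pw_knot m c -> pw_knot m c'.
Proof.
move=> E [m0 [h1 [h2 h3]]]; split=> //; split; first by move=> i hi; rewrite -E//; exact: h1.
split; first by move=> i hi; rewrite -!E ?cyc_next_lt//; exact: h2.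
by move=> i j u w hi hj; rewrite -!E//; exact: h3.
Qed.

Lemma poly_pieces_ext n v v' : (forall i, (i < n)%N -> v i = v' i) ->
  forall i, (i < n)%N -> poly_pieces n v i = poly_pieces n v' i.
Proof.
move=> E i hi; rewrite /poly_pieces !E//; apply: cyc_next_lt.
by apply: leq_ltn_trans hi.
Qed.

Lemma poly_emb_ext n v v' : (forall i, (i < n)%N -> v i = v' i) ->
  poly_emb n v -> poly_emb n v'.
Proof. by move=> E; apply: pw_knot_ext; exact: poly_pieces_ext. Qed.

Lemma curve_set_sub m m' (c c' : nat -> RR -> pt) :
  (forall i u, (i < m)%N -> 0 <= u <= 1 ->
    exists j w, [/\ (j < m')%N, 0 <= w <= 1 & c' j w = c i u]) ->
  curve_set m c `<=` curve_set m' c'.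
Proof.
move=> h x [i [u [hi [hu <-]]]]; have [j [w [hj hw E]]] := h i u hi hu.
by exists j, w.
Qed.

Lemma poly_set_ext n v v' : (forall i, (i < n)%N -> v i = v' i) ->
  poly_set n v = poly_set n v'.
Proof.
move=> E; have pE := poly_pieces_ext E.
by apply/seteqP; split; apply: curve_set_sub => i u hi hu; exists i, u; rewrite pE.
Qed.

Lemma poly_rot n v k : poly_emb n v ->
  poly_emb n (fun i => v ((i + k) %% n)%N) /\
  poly_set n (fun i => v ((i + k) %% n)%N) = poly_set n v.
Proof.
move=> emb; have n0 := emb.1.
have pE i : poly_pieces n (fun i => v ((i + k) %% n)%N) i = poly_pieces n v ((i + k) %% n)%N.
  rewrite /poly_pieces /cyc_next; apply/funext => u; congr (_ *: _ + _ *: v _).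
  by rewrite modnDml -[in RHS]addn1 modnDml addn1 addSn.
split.
  apply: poly_embE => // i j u w hi hj hu hw.
  rewrite !pE => /emb.2.2.2 -/(_ (ltn_pmod _ n0) (ltn_pmod _ n0) hu hw)[/eqP].
  by rewrite eqn_modDr !modn_small// => /eqP.
apply/seteqP; split; apply: curve_set_sub => i u hi hu.
  by exists ((i + k) %% n)%N, u; rewrite ltn_pmod// pE.
exists ((i + (n - k %% n)) %% n)%N, u; rewrite ltn_pmod// pE; split=> //.
congr (poly_pieces n v _ u); rewrite modnDml -addnA -modnDmr -(modnDmr _ k) subnK.
  by rewrite modnn addn0 modn_small.
by rewrite ltnW// ltn_pmod.
Qed.

(** The last vertex, which serves as projection centre, keeps its place. Edge [i] of the new polygon
    is edge [r i] of the old one, traversed backward. *)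
Lemma poly_rev N v : poly_emb N.+1 v ->
  poly_emb N.+1 (fun i => if (i < N)%N then v (N.-1 - i)%N else v N) /\
  poly_set N.+1 (fun i => if (i < N)%N then v (N.-1 - i)%N else v N) = poly_set N.+1 v.
Proof.
move=> emb; set v' := fun i => _.
pose r i := if i == N then N.-1 else if i.+1 == N then N else (N - 2 - i)%N.
have rN i : (i < N.+1)%N -> (r i < N.+1)%N.
  by rewrite /r; do ?[case: eqP => ?]; lia.
have r_inj i j : (i < N.+1)%N -> (j < N.+1)%N -> r i = r j -> i = j.
  by rewrite /r; do ?[case: eqP => ?]; lia.
have rr i : (i < N.+1)%N -> r (r i) = i.
  by rewrite {2}/r; do ?[case: eqP => ?]; rewrite /r; do ?[case: eqP => ?]; lia.
have pE i u : (i < N.+1)%N -> poly_pieces N.+1 v' i u = poly_pieces N.+1 v (r i) (1 - u).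
  move=> hi; rewrite /poly_pieces subKr addrC; congr (_ *: _ + _ *: _).
    rewrite /v' /r cyc_nextE//; case: (i =P N) => [->|iN].
      by rewrite eqxx; case: ltnP => h; congr v; lia.
    have -> : (i.+1 == N.+1) = false by lia.
    by case: (i.+1 =P N) => h; case: ltnP => h'; congr v; lia.
  rewrite cyc_nextE ?rN// /v' /r.
  by case: (i =P N) => h1; [|case: (i.+1 =P N) => h2]; case: ltnP => h3;
    case: eqP => h4; congr v; lia.
split; last first.
  apply/seteqP; split; apply: curve_set_sub => i u hi hu.
    by exists (r i), (1 - u); rewrite rN// -pE//; split=> //; lra.
  exists (r i), (1 - u); rewrite rN// pE ?rN// rr// subKr; split=> //; lra.
apply: poly_embE => // i j u w hi hj hu hw.
rewrite !pE// => /(poly_emb_closed emb (rN _ hi) (rN _ hj)) [||[E ?]|[_ ? ?]|[_ ? ?]].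
- by lra.
- by lra.
- by split; [exact: r_inj|lra].
- by lra.
- by lra.
Qed.

(** * Inserting a vertex *)

Ltac vring := apply/rowP => ?; rewrite !mxE; ring.

(** The projection vertex is kept last, as [poly_add N w 0], so that it can be displaced or followed
    by a further vertex without renumbering the others. *)
Definition poly_add (n : nat) (v : nat -> pt) (b : pt) (i : nat) : pt :=
  if (i < n)%N then v i else b.

Lemma poly_add_pieces n v b i : (i.+1 < n)%N ->
  poly_pieces n.+1 (poly_add n v b) i = poly_pieces n v i.
Proof.
move=> hi; rewrite /poly_pieces /poly_add !cyc_nextE; try lia.
have -> : (i.+1 == n.+1) = false by lia.
have -> : (i.+1 == n) = false by lia.
by rewrite hi; have -> : (i < n)%N by lia.
Qed.

Lemma poly_add_pieces_penult n v b u :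
  poly_pieces n.+2 (poly_add n.+1 v b) n u = (1 - u) *: v n + u *: b.
Proof.
rewrite /poly_pieces /poly_add !cyc_nextE; try lia.
have -> : (n.+1 == n.+2) = false by lia.
by rewrite ltnn ltnSn.
Qed.

Lemma poly_add_pieces_last n v b u :
  poly_pieces n.+2 (poly_add n.+1 v b) n.+1 u = (1 - u) *: b + u *: v 0%N.
Proof. by rewrite /poly_pieces /poly_add !cyc_nextE// eqxx ltnn. Qed.

Lemma poly_subdivide n v :
  poly_set n.+2 (poly_add n.+1 v (2^-1 *: v n + 2^-1 *: v 0%N)) = poly_set n.+1 v.
Proof.
have lastE u : poly_pieces n.+1 v n u = (1 - u) *: v n + u *: v 0%N.
  by rewrite /poly_pieces cyc_nextE// eqxx.
apply/seteqP; split; apply: curve_set_sub => i u hi /andP[u0 u1].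
  have [hi'|hi'] := ltnP i.+1 n.+1.
    by exists i, u; rewrite poly_add_pieces// u0 u1; split=> //; lia.
  have [->|->] : i = n \/ i = n.+1 by lia.
    exists n, (u / 2); split => //; first by lra.
    by rewrite poly_add_pieces_penult lastE; apply/rowP => k; rewrite !mxE; field.
  exists n, (2^-1 + u / 2); split => //; first by lra.
  by rewrite poly_add_pieces_last lastE; apply/rowP => k; rewrite !mxE; field.
have [hi'|hi'] := ltnP i.+1 n.+1.
  by exists i, u; rewrite poly_add_pieces// u0 u1; split=> //; lia.
have -> : i = n by lia.
rewrite lastE; have [u2|u2] := lerP u 2^-1.
  exists n, (2 * u); split; [lia|lra|].
  by rewrite poly_add_pieces_penult; apply/rowP => k; rewrite !mxE; field.
exists n.+1, (2 * u - 1); split; [lia|lra|].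
by rewrite poly_add_pieces_last; apply/rowP => k; rewrite !mxE; field.
Qed.

(* The new vertex travels from the midpoint of the last edge to b, inside the
   empty triangle. *)
Lemma poly_insert n v b : poly_emb n.+1 v ->
  (forall x y z : RR, x *: v n + y *: b + z *: v 0%N = 0 -> x + y + z = 0 ->
     [/\ x = 0, y = 0 & z = 0]) ->
  (forall j u x y z, (j < n)%N -> 0 <= u < 1 -> 0 <= x -> 0 <= y -> 0 <= z ->
     x + y + z = 1 -> poly_pieces n.+1 v j u = x *: v n + y *: b + z *: v 0%N ->
     j = 0%N /\ u = 0) ->
  poly_emb n.+2 (poly_add n.+1 v b) /\
  knot_equiv (poly_set n.+1 v) (poly_set n.+2 (poly_add n.+1 v b)).
Proof.
move=> emb indep empty.
pose m := 2^-1 *: v n + 2^-1 *: v 0%N.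
suff embs s : 0 <= s <= 1 -> poly_emb n.+2 (poly_add n.+1 v ((1 - s) *: m + s *: b)).
  split.
    have := embs 1; rewrite subrr scale0r scale1r add0r; apply; lra.
  rewrite -poly_subdivide; apply: poly_path => s /embs; apply: poly_emb_ext => i _.
  by rewrite /poly_add; case: ifP => // _; vring.
move=> /andP[s0 s1]; set w := _ + _.
(* Barycentric coordinates in the triangle [v n], [b], [v 0] of the points of the two new edges. *)
pose cx i u : RR := if i == n then 1 - u + u * (1 - s) / 2 else (1 - u) * (1 - s) / 2.
pose cy i u : RR := if i == n then u * s else (1 - u) * s.
pose cz i u : RR := if i == n then u * (1 - s) / 2 else (1 - u) * (1 - s) / 2 + u.
have nearE i u : (n <= i < n.+2)%N -> poly_pieces n.+2 (poly_add n.+1 v w) i u =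
    cx i u *: v n + cy i u *: b + cz i u *: v 0%N.
  move=> hi; rewrite /cx /cy /cz; have [->|->] : i = n \/ i = n.+1 by lia.
    by rewrite eqxx poly_add_pieces_penult /w /m; apply/rowP => k; rewrite !mxE; field.
  have -> : (n.+1 == n) = false by lia.
  by rewrite poly_add_pieces_last /w /m; apply/rowP => k; rewrite !mxE; field.
have c1 i u : cx i u + cy i u + cz i u = 1.
  by rewrite /cx /cy /cz; case: eqP => _; field.
have c0 i u : 0 <= u <= 1 -> [/\ 0 <= cx i u, 0 <= cy i u & 0 <= cz i u].
  move=> /andP[u0 u1]; have s2 : 0 <= 1 - s by lra.
  have u2 : 0 <= 1 - u by lra.
  have := mulr_ge0 u0 s0; have := mulr_ge0 u0 s2; have := mulr_ge0 u2 s0.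
  have := mulr_ge0 u2 s2; rewrite /cx /cy /cz; case: eqP => _; split; lra.
have indep' x y z x' y' z' : x *: v n + y *: b + z *: v 0%N = x' *: v n + y' *: b + z' *: v 0%N ->
    x + y + z = 1 -> x' + y' + z' = 1 -> [/\ x = x', y = y' & z = z'].
  move=> E e e'; have [||h1 h2 h3] := indep (x - x') (y - y') (z - z').
  - move/eqP: E; rewrite -subr_eq0 => /eqP E; rewrite -[RHS]E; vring.
  - by vlra.
  - by clear E; split; lra.
(* An old and a new edge could share only the vertex [v 0], which the half-open parameters of the
   new edges leave out. *)
have near_far i j u t : (i < n)%N -> (n <= j < n.+2)%N -> 0 <= u < 1 -> 0 <= t < 1 ->
    poly_pieces n.+2 (poly_add n.+1 v w) i u <> poly_pieces n.+2 (poly_add n.+1 v w) j t.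
  move=> hi hj hu /andP[t0 t1] E; move: (E); rewrite (nearE j)// poly_add_pieces; last by lia.
  have [|h1 h2 h3] := c0 j t; first by lra.
  move=> E'; have [i0 u0] := empty _ _ _ _ _ hi hu h1 h2 h3 (c1 _ _) E'.
  move: E'; rewrite i0 u0 poly_pieces0 => E'.
  have [|||] := indep' 0 0 1 (cx j t) (cy j t) (cz j t).
  - by rewrite -E' !scale0r scale1r !add0r.
  - by rewrite !add0r.
  - exact: c1.
  clear E E'; rewrite /cx /cy /cz.
  have s2 : 0 <= 1 - s by lra.
  have := mulr_ge0 t0 s2.
  by case: eqP => _; lra.
apply: poly_embE => // i j u t hi hj hu ht E.
have [hi'|hi'] := ltnP i n; have [hj'|hj'] := ltnP j n.
- by move: E; rewrite !poly_add_pieces//; apply: emb.2.2.2 => //; lia.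
- by case: (near_far i j u t) => //; lia.
- by case: (near_far j i t u) => //; lia.
have hi2 : (n <= i < n.+2)%N by lia.
have hj2 : (n <= j < n.+2)%N by lia.
move: E; rewrite !nearE// => /indep' /(_ (c1 _ _) (c1 _ _)).
rewrite /cx /cy /cz; case: eqP => hi3; case: eqP => hj3 [h1 h2 h3].
- by split; [lia|lra].
- lra.
- lra.
- by split; [lia|lra].
Qed.

(** * Triangles are unknotted *)

Local Notation cx u := (u ord0 0).
Local Notation cy u := (u ord0 1).
Local Notation cz u := (u ord0 2%:R).

Lemma ord3_ind (P : 'I_3 -> Prop) : P 0 -> P 1 -> P 2%:R -> forall k, P k.
Proof.
move=> h0 h1 h2 -[[|[|[|//]]] hk].
- by have -> : Ordinal hk = 0 by exact: val_inj.
- by have -> : Ordinal hk = 1 by exact: val_inj.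
- by have -> : Ordinal hk = 2%:R by exact: val_inj.
Qed.

Lemma pt_ext (u v : pt) : cx u = cx v -> cy u = cy v -> cz u = cz v -> u = v.
Proof. by move=> h0 h1 h2; apply/rowP; exact: ord3_ind. Qed.

(** * Cross products and determinants in coordinates *)

Definition vec (a b c : RR) : pt := \row_k [:: a; b; c]`_k.
Lemma vecx a b c : cx (vec a b c) = a. Proof. by rewrite mxE. Qed.
Lemma vecy a b c : cy (vec a b c) = b. Proof. by rewrite mxE. Qed.
Lemma vecz a b c : cz (vec a b c) = c. Proof. by rewrite mxE. Qed.
Definition vecE := (vecx, vecy, vecz).

Definition crossp (u v : pt) : pt :=
  vec (cy u * cz v - cz u * cy v) (cz u * cx v - cx u * cz v) (cx u * cy v - cy u * cx v).

Lemma dotpE u v : dotp u v = cx u * cx v + cy u * cy v + cz u * cz v.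
Proof.
rewrite /dotp !big_ord_recr big_ord0 /= add0r.
by congr (_ * _ + _ * _ + _ * _); congr (_ ord0 _); exact: val_inj.
Qed.

Definition tri (u v w : pt) : RR := dotp (crossp u v) w.

Lemma triE u v w : tri u v w =
  (cy u * cz v - cz u * cy v) * cx w + (cz u * cx v - cx u * cz v) * cy w
  + (cx u * cy v - cy u * cx v) * cz w.
Proof. by rewrite /tri dotpE !vecE. Qed.

Lemma tri_rot u v w : tri v w u = tri u v w.
Proof. by rewrite !triE; ring. Qed.

Lemma tri_swap u v w : tri v u w = - tri u v w.
Proof. by rewrite !triE; ring. Qed.

(** Cramer's rule: each coefficient times the determinant is a combination of the three coordinate
    equations, weighted by cofactors. *)
Lemma tri_free u v w x y z : tri u v w != 0 -> x *: u + y *: v + z *: w = 0 ->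
  [/\ x = 0, y = 0 & z = 0].
Proof.
move=> ne E.
have ex : x * cx u + y * cx v + z * cx w = 0.
  by have := congr1 (fun p : pt => cx p) E; rewrite !mxE.
have ey : x * cy u + y * cy v + z * cy w = 0.
  by have := congr1 (fun p : pt => cy p) E; rewrite !mxE.
have ez : x * cz u + y * cz v + z * cz w = 0.
  by have := congr1 (fun p : pt => cz p) E; rewrite !mxE.
split; apply: (mulIf ne); rewrite mul0r triE.
- transitivity ((x * cx u + y * cx v + z * cx w) * (cy v * cz w - cz v * cy w)
    + (x * cy u + y * cy v + z * cy w) * (cz v * cx w - cx v * cz w)
    + (x * cz u + y * cz v + z * cz w) * (cx v * cy w - cy v * cx w)); first by ring.
  by rewrite ex ey ez !mul0r !addr0.
- transitivity ((x * cx u + y * cx v + z * cx w) * (cy w * cz u - cz w * cy u)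
    + (x * cy u + y * cy v + z * cy w) * (cz w * cx u - cx w * cz u)
    + (x * cz u + y * cz v + z * cz w) * (cx w * cy u - cy w * cx u)); first by ring.
  by rewrite ex ey ez !mul0r !addr0.
- transitivity ((x * cx u + y * cx v + z * cx w) * (cy u * cz v - cz u * cy v)
    + (x * cy u + y * cy v + z * cy w) * (cz u * cx v - cx u * cz v)
    + (x * cz u + y * cz v + z * cz w) * (cx u * cy v - cy u * cx v)); first by ring.
  by rewrite ex ey ez !mul0r !addr0.
Qed.

(** Splitting off the power of X that vanishes at 0 leaves a factor with nonzero value at 0, which
    stays nonzero nearby by continuity. *)
Lemma gen_poly_nonzero_near0 (R : realType) (p : {poly R}) : p != 0 ->
  exists2 e : R, 0 < e & forall t, 0 < t < e -> p.[t] != 0.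
Proof.
move=> p0; have [m [q]] := multiplicity_XsubC p 0; rewrite p0 /= => q0 ->.
have /cvgrPdist_lt/(_ `|q.[0]|) : horner q t @[t --> 0] --> q.[0] by exact: continuous_horner.
rewrite normr_gt0 => /(_ q0) /nbhs_ballP[e /= e0 he].
exists e => // t /andP[t0 te]; rewrite hornerM horner_exp hornerXsubC subr0.
apply: mulf_neq0; last by rewrite expf_neq0// lt0r_neq0.
have bt : ball 0 e t by rewrite /ball /= sub0r normrN ger0_norm// ltW.
have {bt} h : `|q.[0] - q.[t]| < `|q.[0]| := he t bt.
by apply: contraTN h => /eqP ->; rewrite subr0 ltxx.
Qed.

Lemma poly_nonzero_near0 (p : {poly RR}) : p != 0 ->
  exists2 e : RR, 0 < e & forall t, 0 < t < e -> p.[t] != 0.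
Proof. exact: gen_poly_nonzero_near0. Qed.

Lemma quadratic_nonzero_near0 (a b c : RR) : [|| a != 0, b != 0 | c != 0] ->
  exists2 e : RR, 0 < e & forall t, 0 < t < e -> a + b * t + c * t ^+ 2 != 0.
Proof.
move=> abc; have [|e e0 he] := @poly_nonzero_near0 (a%:P + b *: 'X + c *: 'X^2).
  apply: contraTneq abc => E; rewrite !negb_or !negbK.
  have co i : (a%:P + b *: 'X + c *: 'X^2)`_i = 0 by rewrite E coef0.
  have := co 0%N; have := co 1%N; have := co 2%N.
  rewrite !coefE /= !(mulr0, mulr1, addr0, add0r) => -> -> ->.
  by rewrite eqxx.
by exists e => // t /he; rewrite !hornerE.
Qed.

(** Given by a vertex and two sides, so that embeddedness becomes linear independence of [a] and
    [b]. *)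
Definition triangle (p a b : pt) (i : nat) : pt :=
  if i == 0%N then p else if i == 1%N then p + a else p + b.

Lemma triangle_emb p a b : (forall x y : RR, x *: a + y *: b = 0 -> x = 0 /\ y = 0) ->
  poly_emb 3 (triangle p a b).
Proof.
move=> indep.
pose ca i u : RR := if i == 0%N then u else if i == 1%N then 1 - u else 0.
pose cb i u : RR := if i == 0%N then 0 else if i == 1%N then u else 1 - u.
have pE i u : (i < 3)%N -> poly_pieces 3 (triangle p a b) i u = p + (ca i u *: a + cb i u *: b).
  by move: i => [|[|[|//]]] _; rewrite /poly_pieces /triangle /ca /cb /=; vring.
apply: poly_embE => // i j u w hi hj hu hw; rewrite !pE// => /addrI /eqP.
rewrite -subr_eq0 => /eqP E.
have [|] := indep (ca i u - ca j w) (cb i u - cb j w).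
  by rewrite -[RHS]E; vring.
move: i j hi hj {E} => [|[|[|//]]] [|[|[|//]]] _ _; rewrite /ca /cb /= => h1 h2.
all: match goal with |- ?i = ?i /\ _ => split=> //; clear -h1 h2; lra | _ => exfalso; lra end.
Qed.

(** The signs make [v k] a convex combination of the other two vertices, hence a point of the
    opposite edge. *)
Lemma triangle_vertex v k (x y z : RR) : poly_emb 3 v -> (k < 3)%N ->
  x + y + z = 0 -> x != 0 -> x * y <= 0 -> x * z <= 0 ->
  x *: v k + y *: v (cyc_next 3 k) + z *: v (cyc_next 3 (cyc_next 3 k)) <> 0.
Proof.
move=> emb hk s0 x0 xy xz E.
have x2 : 0 < x ^+ 2 by rewrite exprn_even_gt0.
have yE : y = - x - z by vlra.
have t0 : 0 <= - z / x.
  have -> : - z / x = (- (x * z)) / x ^+ 2 by field.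
  by rewrite divr_ge0// ?oppr_ge0// ltW.
have t1 : - z / x <= 1.
  have : 0 <= - y / x.
    have -> : - y / x = (- (x * y)) / x ^+ 2 by field.
    by rewrite divr_ge0// ?oppr_ge0// ltW.
  have -> : - y / x = 1 + z / x by rewrite yE; field.
  by rewrite mulNr; lra.
have : poly_pieces 3 v k 0 = poly_pieces 3 v (cyc_next 3 k) (- z / x).
  rewrite poly_pieces0 /poly_pieces; apply: (scalerI x0); apply/eqP.
  rewrite -subr_eq0 -[X in _ == X]E; apply/eqP.
  rewrite yE; by apply/rowP => j; rewrite !mxE; field.
move=> /(poly_emb_closed emb hk (cyc_next_lt _ _)) [//|||[h _]|[_ h _]|[h h1 h2]].
- by rewrite lexx ler01.
- by rewrite t0 t1.
- by move: h; case: k hk {E} => [|[|[|//]]].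
- by vlra.
- by move: h; case: k hk {E} => [|[|[|//]]].
Qed.

(** A relation between the sides is a relation between the vertices with coefficients of sum 0. If
    it is nontrivial, some nonzero coefficient has sign opposite to the other two, and
    [triangle_vertex] excludes this. *)
Lemma triangle_indep v : poly_emb 3 v -> forall x y : RR,
  x *: (v 1%N - v 0%N) + y *: (v 2%N - v 0%N) = 0 -> x = 0 /\ y = 0.
Proof.
move=> emb x y E.
have E0 : (- x - y) *: v 0%N + x *: v 1%N + y *: v 2%N = 0 by rewrite -[RHS]E; vring.
have E1 : x *: v 1%N + y *: v 2%N + (- x - y) *: v 0%N = 0 by rewrite -[RHS]E; vring.
have E2 : y *: v 2%N + (- x - y) *: v 0%N + x *: v 1%N = 0 by rewrite -[RHS]E; vring.
have H0 := @triangle_vertex v 0%N (- x - y) x y emb isT.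
have H1 := @triangle_vertex v 1%N x y (- x - y) emb isT.
have H2 := @triangle_vertex v 2%N y (- x - y) x emb isT.
rewrite /cyc_next /= in H0 H1 H2.
have [x0|x0] := eqVneq x 0.
  have [y0|y0] := eqVneq y 0; first by split.
  exfalso; apply: (H2 _ y0 _ _ E2); rewrite x0; first by clear; lra.
    by rewrite oppr0 add0r mulrN oppr_le0 -expr2 sqr_ge0.
  by rewrite mulr0.
exfalso.
have [xy|xy] := leP (x * y) 0; last first.
  apply: (H0 _ _ _ _ E0); first by clear; lra.
  - apply/eqP => h; have h' : y = - x by clear -h; lra.
    have := sqr_ge0 x; rewrite expr2; move: xy; rewrite h'; clear; lra.
  - by have := sqr_ge0 x; rewrite expr2; clear -xy; lra.
  - by have := sqr_ge0 y; rewrite expr2; clear -xy; lra.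
have [xz|xz] := leP (x * (- x - y)) 0.
  by apply: (H1 _ x0 xy xz E1); clear; lra.
have y0 : y != 0.
  apply/eqP => h; have := sqr_ge0 x; rewrite expr2; move: xz; rewrite h; clear; lra.
apply: (H2 _ y0 _ _ E2); first by clear; lra.
- have [//|y2] := leP (y * (- x - y)) 0.
  have : (x + y) * (- x - y) > 0 by clear -xz y2; lra.
  have := sqr_ge0 (x + y); rewrite expr2; clear; lra.
- by rewrite mulrC.
Qed.

(** Independence of [a], [b], [c] keeps the moving side independent of [b], so the triangle stays
    embedded on the way from [a] to [c]. *)
Lemma triangle_move1 p a b c : tri a b c != 0 ->
  knot_equiv (poly_set 3 (triangle p a b)) (poly_set 3 (triangle p c b)).
Proof.
move=> ne; apply: poly_path => s s01.
apply: (@poly_emb_ext _ (triangle p ((1 - s) *: a + s *: c) b)).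
  by move=> [|[|[|//]]] _; rewrite /triangle /=; vring.
apply: triangle_emb => x y E.
have [||h1 h2 h3] := @tri_free a b c (x * (1 - s)) y (x * s) => //.
  by rewrite -[RHS]E; vring.
by clear E; split=> //; lra.
Qed.

Lemma triangle_move2 p a b c : tri a b c != 0 ->
  knot_equiv (poly_set 3 (triangle p a b)) (poly_set 3 (triangle p a c)).
Proof.
move=> ne; apply: poly_path => s s01.
apply: (@poly_emb_ext _ (triangle p a ((1 - s) *: b + s *: c))).
  by move=> [|[|[|//]]] _; rewrite /triangle /=; vring.
apply: triangle_emb => x y E.
have [||h1 h2 h3] := @tri_free a b c x (y * (1 - s)) (y * s) => //.
  by rewrite -[RHS]E; vring.
by clear E; split=> //; lra.
Qed.

(** The factor may have no limit at 0; its boundedness is enough for continuity of the product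
    there. *)
Lemma gen_scaled_continuous (R : realType) (V : normedModType R) (h : V -> R) (C : R) :
  (forall x, x != 0 -> {for x, continuous h}) -> (forall x, x != 0 -> `|h x| <= C) ->
  continuous (fun x => h x *: x).
Proof.
move=> ch hC x; have [->|x0] := eqVneq x 0; last by apply: cvgZ; [exact: ch|exact: cvg_id].
have C1 : 0 < `|C| + 1 by rewrite ltr_wpDl.
have le y : `|h y *: y| <= (`|C| + 1) * `|y|.
  have [->|y0] := eqVneq y 0; first by rewrite scaler0 normr0 mulr0.
  rewrite normrZ; apply: ler_wpM2r => //.
  by rewrite (le_trans (hC _ y0))// (le_trans (ler_norm C))// lerDl.
apply/cvgrPdist_lt => e e0; near=> y.
rewrite scaler0 sub0r normrN; apply: (le_lt_trans (le y)).
rewrite mulrC -ltr_pdivlMr// -[y]opprK normrN -sub0r.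
near: y; have /cvgrPdist_lt : id @ (0 : V) --> (0 : V) by exact: cvg_id.
by apply; exact: divr_gt0.
Unshelve. all: by end_near. Qed.

Lemma scaled_continuous (h : pt -> RR) (C : RR) :
  (forall x, x != 0 -> {for x, continuous h}) -> (forall x, x != 0 -> `|h x| <= C) ->
  continuous (fun x => h x *: x).
Proof. exact: gen_scaled_continuous. Qed.

(** On each open ray the map at time t multiplies by the constant [1 - t + t * q x], so its inverse
    divides by the same factor; the lower bound on [q] keeps this factor away from 0. *)
Lemma radial_isotopy (q : pt -> RR) (a b : RR) :
  (forall x, x != 0 -> {for x, continuous q}) -> 0 < a ->
  (forall x, x != 0 -> a <= q x <= b) ->
  (forall (c : RR) x, 0 < c -> q (c *: x) = q x) ->
  ambient_isotopy (fun t x => (1 - t) *: x + t *: (q x *: x)).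
Proof.
move=> cq a0 qab qZ.
have cF : continuous (fun x => q x *: x).
  apply: (@scaled_continuous q b) => // x /qab/andP[h1 h2].
  by rewrite ger0_norm//; apply: le_trans h1; exact: ltW.
split.
  move=> p; apply: (@continuousDv (RR * pt)%type).
    apply: (@continuousZv (RR * pt)%type _ snd); last exact: cvg_snd.
    apply: (@continuousDr (RR * pt)%type (fun=> 1)); first exact: cst_continuous.
    by apply: (@continuousNr (RR * pt)%type); exact: cvg_fst.
  apply: (@continuousZv (RR * pt)%type); first exact: cvg_fst.
  by apply: (@continuous_comp _ _ _ snd (fun x => q x *: x)); [exact: cvg_snd|exact: cF].
split; first by move=> x; rewrite subr0 scale1r scale0r addr0.
move=> t /andP[t0 t1].
pose g x := 1 - t + t * q x.
have HE x : (1 - t) *: x + t *: (q x *: x) = g x *: x.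
  by rewrite /g [RHS]scalerDl scalerA.
pose m := Num.min 1 a.
have m0 : 0 < m by rewrite lt_min ltr01.
have gm x : x != 0 -> m <= g x.
  move=> x0; have /andP[qa _] := qab x x0.
  have m1 : m <= 1 by rewrite ge_min lexx.
  have ma : m <= q x by apply: le_trans qa; rewrite ge_min lexx orbT.
  have := ler_wpM2l t0 ma; have : 0 <= 1 - t by lra.
  by move=> /ler_wpM2l/(_ _ _ m1); rewrite /g; lra.
have cg x : x != 0 -> {for x, continuous g}.
  move=> x0; apply: (@continuousDr pt (fun=> 1 - t)); first exact: cst_continuous.
  apply: (@continuousMr pt (fun=> t)); [exact: cst_continuous|exact: cq].
have gZ (c : RR) x : 0 < c -> g (c *: x) = g x by move=> c0; rewrite /g qZ.
exists (fun y => (g y)^-1 *: y); split.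
  move=> x; apply: (@continuousDv pt (fun x => (1 - t) *: x)); last first.
    by apply: (@continuousZv pt (fun=> t)); [exact: cst_continuous|exact: cF].
  by apply: (@continuousZv pt (fun=> 1 - t) id); [exact: cst_continuous|exact: cvg_id].
split.
  apply: (@scaled_continuous (fun y => (g y)^-1) m^-1) => x x0; have gx := gm x x0.
    by apply: (@continuousVr pt); [apply: lt0r_neq0; lra|exact: cg].
  by rewrite ger0_norm ?invr_ge0 ?lef_pV2 ?posrE//; lra.
split=> x; rewrite HE; have [->|x0] := eqVneq x 0; rewrite ?scaler0//.
  have gx := gm x x0; rewrite gZ; last by lra.
  by rewrite scalerA mulVf ?scale1r//; apply: lt0r_neq0; lra.
have gx := gm x x0; rewrite gZ; last by rewrite invr_gt0; lra.
by rewrite scalerA mulfV ?scale1r//; apply: lt0r_neq0; lra.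
Qed.

Lemma gen_continuous_sqrt (R : realType) (T : topologicalType) (f : T -> R) x :
  {for x, continuous f} -> {for x, continuous (fun t => Num.sqrt (f t))}.
Proof. by move=> cf; apply: (@continuous_comp _ _ _ f Num.sqrt); [|exact: sqrt_continuous]. Qed.

Lemma continuous_sqrtr (T : topologicalType) (f : T -> RR) x :
  {for x, continuous f} -> {for x, continuous (fun t => Num.sqrt (f t))}.
Proof. exact: gen_continuous_sqrt. Qed.

Lemma gen_continuous_abs (R : realType) (T : topologicalType) (f : T -> R) x :
  {for x, continuous f} -> {for x, continuous (fun t => `|f t|)}.
Proof. exact: cvg_norm. Qed.

Lemma continuous_absr (T : topologicalType) (f : T -> RR) x :
  {for x, continuous f} -> {for x, continuous (fun t => `|f t|)}.
Proof. exact: gen_continuous_abs. Qed.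

(* In the plane z = 0 its unit sphere is the triangle with vertices
   (-1,-1), (2,-1), (-1,2). *)
Definition triangle_gauge (x : pt) : RR :=
  Num.max (Num.max (- cx x) (- cy x)) (Num.max (cx x + cy x) `|cz x|).

Definition euclid_norm (x : pt) : RR := Num.sqrt (cx x ^+ 2 + cy x ^+ 2 + cz x ^+ 2).

Lemma triangle_gauge_ge x : 2^-1 * `|x| <= triangle_gauge x.
Proof.
set N := triangle_gauge x.
have h1 : - cx x <= N by rewrite /N /triangle_gauge !le_max lexx.
have h2 : - cy x <= N by rewrite /N /triangle_gauge !le_max lexx !orbT.
have h3 : cx x + cy x <= N by rewrite /N /triangle_gauge !le_max lexx !orbT.
have h4 : `|cz x| <= N by rewrite /N /triangle_gauge !le_max lexx !orbT.
rewrite ler_pdivrMl//; apply: norm_le_coord.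
  by have := normr_ge0 (cz x); lra.
move: h4; rewrite ler_norml => h4.
by apply: ord3_ind; rewrite ler_norml; lra.
Qed.

Lemma triangle_gauge_le x : triangle_gauge x <= 2 * `|x|.
Proof.
have := coord_le_norm x 0; have := coord_le_norm x 1; have := coord_le_norm x 2%:R.
rewrite !ler_norml => hz hy hx.
have hz' : `|cz x| <= 2 * `|x| by rewrite ler_norml; lra.
by rewrite /triangle_gauge !ge_max hz' andbT; lra.
Qed.

Lemma euclid_norm_ge x : `|x| <= euclid_norm x.
Proof.
have s1 := sqr_ge0 (cx x); have s2 := sqr_ge0 (cy x); have s3 := sqr_ge0 (cz x).
apply: norm_le_coord; first exact: sqrtr_ge0.
by apply: ord3_ind; rewrite -sqrtr_sqr; apply: ler_wsqrtr; lra.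
Qed.

Lemma euclid_norm_le x : euclid_norm x <= 2 * `|x|.
Proof.
have le k : x ord0 k ^+ 2 <= `|x| ^+ 2.
  by rewrite -[leLHS]real_normK ?num_real// lerXn2r ?nnegrE//; exact: coord_le_norm.
have h : 0 <= 2 * `|x| by rewrite mulr_ge0.
rewrite -[leRHS](ger0_norm h) -sqrtr_sqr /euclid_norm.
apply: ler_wsqrtr; have := le 0; have := le 1; have := le 2%:R.
by have := sqr_ge0 `|x|; rewrite exprMn; lra.
Qed.

Lemma triangle_gaugeZ (c : RR) x : 0 < c -> triangle_gauge (c *: x) = c * triangle_gauge x.
Proof.
move=> c0; rewrite /triangle_gauge !mxE normrM (gtr0_norm c0).
by rewrite -!mulrN -mulrDr -!maxr_pMr// ltW.
Qed.

Lemma euclid_normZ (c : RR) x : 0 < c -> euclid_norm (c *: x) = c * euclid_norm x.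
Proof.
move=> c0; rewrite /euclid_norm !mxE !exprMn -!mulrDr sqrtrM ?sqr_ge0//.
by rewrite sqrtr_sqr gtr0_norm.
Qed.

(** Scaling by this factor takes the unit sphere of the gauge to the Euclidean one along rays. The
    norm of [pt] is the sup norm, hence the separate [euclid_norm]. *)
Definition gauge_ratio (x : pt) : RR := triangle_gauge x / euclid_norm x.

Lemma gauge_ratio_isotopy :
  ambient_isotopy (fun t x => (1 - t) *: x + t *: (gauge_ratio x *: x)).
Proof.
have en0 x : x != 0 -> 0 < euclid_norm x.
  by move=> x0; apply: lt_le_trans (euclid_norm_ge x); rewrite normr_gt0.
apply: (@radial_isotopy _ (4^-1) 2); last 2 first.
- move=> x x0; have n0 : 0 < `|x| by rewrite normr_gt0.
  rewrite /gauge_ratio ler_pdivlMr ?en0// ler_pdivrMr ?en0//.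
  have := euclid_norm_ge x; have := euclid_norm_le x.
  by have := triangle_gauge_ge x; have := triangle_gauge_le x; lra.
- move=> c x c0; rewrite /gauge_ratio triangle_gaugeZ// euclid_normZ//.
  by rewrite -mulf_div divff ?mul1r// lt0r_neq0.
- move=> x x0; rewrite /gauge_ratio.
  have cc k : {for x, continuous (fun y : pt => y ord0 k)}.
    by apply: (@continuous_coord pt id); exact: cvg_id.
  apply: (@continuousMr pt).
    apply: (@continuous_maxr pt); apply: (@continuous_maxr pt).
    - exact: (@continuousNr pt).
    - exact: (@continuousNr pt).
    - exact: (@continuousDr pt).
    - exact: (@continuous_absr pt).
  apply: (@continuousVr pt); first by rewrite lt0r_neq0// en0.
  apply: (@continuous_sqrtr pt); apply: (@continuousDr pt); first apply: (@continuousDr pt).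
  - exact: (@continuousMr pt _ _ _ (cc 0) (cc 0)).
  - exact: (@continuousMr pt _ _ _ (cc 1) (cc 1)).
  - exact: (@continuousMr pt _ _ _ (cc 2%:R) (cc 2%:R)).
- by lra.
Qed.

Definition std_triangle : nat -> pt := triangle (vec (-1) (-1) 0) (vec 3 0 0) (vec 0 3 0).

Lemma std_triangleE : poly_set 3 std_triangle =
  [set x : pt | cz x = 0 /\ triangle_gauge x = 1].
Proof.
have gE (x : pt) : cz x = 0 -> triangle_gauge x = 1 <->
    [/\ - cx x <= 1, - cy x <= 1, cx x + cy x <= 1 & [\/ cx x = -1, cy x = -1 | cx x + cy x = 1]].
  move=> z0; rewrite /triangle_gauge z0 normr0; split.
    move=> E; have : [&& - cx x <= 1, - cy x <= 1 & cx x + cy x <= 1].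
      by rewrite -E !le_max !lexx !orbT.
    move=> /and3P[h1 h2 h3]; split=> //; move: E.
    have [?|n1] := eqVneq (cx x) (-1); first by constructor 1.
    have [?|n2] := eqVneq (cy x) (-1); first by constructor 2.
    have [?|n3] := eqVneq (cx x + cy x) 1; first by constructor 3.
    have l1 : - cx x < 1.
      by rewrite lt_neqAle h1 andbT; apply: contra n1 => /eqP h; apply/eqP; lra.
    have l2 : - cy x < 1.
      by rewrite lt_neqAle h2 andbT; apply: contra n2 => /eqP h; apply/eqP; lra.
    have l3 : cx x + cy x < 1 by rewrite lt_neqAle h3 andbT.
    move=> E; have : 1 < 1 :> RR by rewrite -{1}E !gt_max l1 l2 l3 ltr01.
    by rewrite ltxx.
  move=> [h1 h2 h3 h4]; apply/eqP; rewrite eq_le !ge_max !le_max h1 h2 h3 ler01 /=.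
  by case: h4 => h; apply/orP; [left; apply/orP; left|left; apply/orP; right|right; apply/orP; left]; lra.
have pE i u : (i < 3)%N -> poly_pieces 3 std_triangle i u =
    if i == 0%N then vec (3 * u - 1) (-1) 0 else
    if i == 1%N then vec (2 - 3 * u) (3 * u - 1) 0 else vec (-1) (2 - 3 * u) 0.
  by move: i => [|[|[|//]]] _; rewrite /poly_pieces /std_triangle /triangle /=;
    apply: pt_ext; rewrite !mxE /=; ring.
apply/seteqP; split=> [x [i [u [hi [hu <-]]]]|x [z0 /(gE _ z0) [h1 h2 h3 h4]]].
  rewrite pE//; split; first by case: eqP => _; [|case: eqP => _]; rewrite vecz.
  apply/gE; first by case: eqP => _; [|case: eqP => _]; rewrite vecz.
  case: eqP => _; [|case: eqP => _]; rewrite !vecE; split; try lra.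
  - by constructor 2.
  - by constructor 3; lra.
  - by constructor 1.
case: h4 => h.
- exists 2%N, ((2 - cy x) / 3); split=> //; split; first by lra.
  by rewrite pE//=; apply: pt_ext; rewrite !vecE ?h ?z0//; field.
- exists 0%N, ((cx x + 1) / 3); split=> //; split; first by lra.
  by rewrite pE//=; apply: pt_ext; rewrite !vecE ?h ?z0//; field.
- exists 1%N, ((2 - cx x) / 3); split=> //; split; first by lra.
  rewrite pE//=; apply: pt_ext; rewrite !vecE ?z0//; first by field.
  have -> : cy x = 1 - cx x by lra.
  by field.
Qed.

Lemma std_triangle_round : knot_equiv (poly_set 3 std_triangle) round_circle.
Proof.
exists (fun t x => (1 - t) *: x + t *: (gauge_ratio x *: x)); split.
  exact: gauge_ratio_isotopy.
rewrite std_triangleE; apply/seteqP; split.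
  move=> _ [x [z0 g1] <-]; rewrite subrr scale0r add0r scale1r /gauge_ratio g1 div1r.
  split; rewrite !mxE ?z0 ?mulr0// !exprMn -mulrDr exprVn.
  have : euclid_norm x ^+ 2 = cx x ^+ 2 + cy x ^+ 2.
    by rewrite sqr_sqrtr z0 ?expr0n ?addr0// addr_ge0// sqr_ge0.
  move=> <-; rewrite mulVf// expf_eq0 /=; apply: lt0r_neq0.
  have := triangle_gauge_le x; have := euclid_norm_ge x; lra.
move=> y [z0 e1].
have en : euclid_norm y = 1 by rewrite /euclid_norm e1 z0 expr0n addr0 sqrtr1.
have g0 : 0 < triangle_gauge y.
  by have := triangle_gauge_ge y; have := euclid_norm_le y; lra.
exists ((triangle_gauge y)^-1 *: y).
  by split; rewrite ?mxE ?z0 ?mulr0// triangle_gaugeZ ?invr_gt0// mulVf// lt0r_neq0.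
rewrite subrr scale0r add0r scale1r /gauge_ratio triangle_gaugeZ ?invr_gt0// euclid_normZ ?invr_gt0//.
by rewrite en mulr1 mulVf ?lt0r_neq0// div1r invrK scalerA mulfV ?scale1r// lt0r_neq0.
Qed.

Lemma poly_set_translate n v b :
  poly_set n (fun i => v i + b) = [set x + b | x in poly_set n v].
Proof.
have pE i u : poly_pieces n (fun i => v i + b) i u = poly_pieces n v i u + b.
  by rewrite /poly_pieces; vring.
apply/seteqP; split=> [x [i [u [hi [hu <-]]]]|_ [x [i [u [hi [hu <-]]]] <-]].
  by exists (poly_pieces n v i u); [exists i, u|rewrite pE].
by exists i, u.
Qed.

(** If the cross product vanishes, then [b_k a - a_k b = 0] for every coordinate k, and independence
    makes every [b_k] zero. *)
Lemma crossp_neq0 a b : (forall x y : RR, x *: a + y *: b = 0 -> x = 0 /\ y = 0) ->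
  crossp a b != 0.
Proof.
move=> indep; apply/eqP => E.
have hx := congr1 (fun p : pt => cx p) E.
have hy := congr1 (fun p : pt => cy p) E.
have hz := congr1 (fun p : pt => cz p) E.
rewrite /= !vecE !mxE in hx hy hz; clear E.
have bk k : b ord0 k = 0.
  have [|+ _] := indep (b ord0 k) (- a ord0 k); last by [].
  by move: k; apply: ord3_ind; apply: pt_ext; rewrite !mxE; clear -hx hy hz; lra.
have b0 : b = 0 by apply/rowP => k; rewrite bk mxE.
have [|_] := indep 0 1; first by rewrite b0 scaler0 scale0r addr0.
by move/eqP; rewrite oner_eq0.
Qed.

(* The sides a, b reach those of the standard triangle one at a time, each time
   leaving the plane of the triangle, through auxiliary sides x and y. *)
Lemma triangle_round p a b : (forall x y : RR, x *: a + y *: b = 0 -> x = 0 /\ y = 0) ->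
  knot_equiv (poly_set 3 (triangle p a b)) round_circle.
Proof.
move=> indep; have c0 := crossp_neq0 indep.
have b0 : b != 0.
  apply/eqP => b0; have [|_] := indep 0 1; first by rewrite b0 scaler0 scale0r addr0.
  by move/eqP; rewrite oner_eq0.
have coord0 (u : pt) : u != 0 -> [|| cx u != 0, cy u != 0 | cz u != 0].
  apply: contraR; rewrite !negb_or !negbK => /and3P[/eqP h1 /eqP h2 /eqP h3].
  by apply/eqP; apply: pt_ext; rewrite ?h1 ?h2 ?h3 mxE.
(* For [x] and [y] on the moment curve at parameters [t] and [t + 1], [tri a b x] and [tri x y b]
   are quadratic in [t]; one small [t] makes both nonzero. *)
have [e1 e10 h1] := quadratic_nonzero_near0 (coord0 _ c0).
have [|e2 e20 h2] := @quadratic_nonzero_near0 (cz b - cy b) (cx b - 2 * cy b) (cx b).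
  have := coord0 _ b0; apply: contraTT; rewrite !negb_or !negbK => /and3P[/eqP h /eqP h' /eqP h''].
  by apply/and3P; split; apply/eqP; lra.
pose t := Num.min e1 e2 / 2.
have m0 : 0 < Num.min e1 e2 by rewrite lt_min e10.
have t0 : 0 < t by rewrite divr_gt0.
have t1 : t < e1 by apply: (@lt_le_trans _ _ (Num.min e1 e2)); [rewrite /t; lra|rewrite ge_min lexx].
have t2 : t < e2 by apply: (@lt_le_trans _ _ (Num.min e1 e2)); [rewrite /t; lra|rewrite ge_min lexx orbT].
have {}h1 := h1 t; have {}h2 := h2 t.
rewrite t0 t1 in h1; rewrite t0 t2 in h2; have {}h1 := h1 isT; have {}h2 := h2 isT.
have tt : 0 < t * (t + 1) by rewrite mulr_gt0//; lra.
pose x := vec 1 t (t ^+ 2); pose y := vec 1 (t + 1) ((t + 1) ^+ 2).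
have E1 : knot_equiv (poly_set 3 (triangle p a b)) (poly_set 3 (triangle p x b)).
  apply: triangle_move1; apply: contra h1 => /eqP h; apply/eqP; rewrite -h.
  by rewrite /tri dotpE /x !vecE; ring.
have E2 : knot_equiv (poly_set 3 (triangle p x b)) (poly_set 3 (triangle p x y)).
  apply: triangle_move2; apply: contra h2 => /eqP h; apply/eqP; rewrite -[RHS]oppr0 -h.
  by rewrite triE /x /y !vecE; ring.
have E3 : knot_equiv (poly_set 3 (triangle p x y)) (poly_set 3 (triangle p (vec 3 0 0) y)).
  apply: triangle_move1; have -> : tri x y (vec 3 0 0) = 3 * (t * (t + 1)).
    by rewrite triE /x /y !vecE; ring.
  by apply: lt0r_neq0; lra.
have E4 : knot_equiv (poly_set 3 (triangle p (vec 3 0 0) y))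
    (poly_set 3 (triangle p (vec 3 0 0) (vec 0 3 0))).
  apply: triangle_move2; have -> : tri (vec 3 0 0) y (vec 0 3 0) = - (9 * (t + 1) ^+ 2).
    by rewrite triE /y !vecE; ring.
  rewrite oppr_eq0; apply: lt0r_neq0; rewrite mulr_gt0// exprn_gt0//; lra.
apply: knot_equiv_trans E1 _; apply: knot_equiv_trans E2 _.
apply: knot_equiv_trans E3 _; apply: knot_equiv_trans E4 _.
apply: knot_equiv_trans std_triangle_round.
apply: (knot_equiv_trans (knot_equiv_translate _ (vec (-1) (-1) 0 - p))).
rewrite -poly_set_translate (_ : poly_set 3 _ = poly_set 3 std_triangle); first exact: knot_equiv_refl.
apply: poly_set_ext => -[|[|[|//]]] _; rewrite /std_triangle /triangle /=.
- by rewrite addrC subrK.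
- by rewrite addrC addrA subrK.
- by rewrite addrC addrA subrK.
Qed.

Lemma poly3_round v : poly_emb 3 v -> knot_equiv (poly_set 3 v) round_circle.
Proof.
move=> emb; have -> : poly_set 3 v = poly_set 3 (triangle (v 0%N) (v 1%N - v 0%N) (v 2%N - v 0%N)).
  by apply: poly_set_ext => -[|[|[|//]]] _; rewrite /triangle /= ?(addrC (v 0%N)) ?subrK.
exact: triangle_round (triangle_indep emb).
Qed.

(** * General position *)

(* The last vertex becomes one that is farthest from the origin, so that all the
   others are seen from it inside an open half-space. *)
Lemma poly_normalize N v : poly_emb N.+1 v -> exists w h,
  [/\ poly_emb N.+1 (poly_add N w 0),
      knot_equiv (poly_set N.+1 v) (poly_set N.+1 (poly_add N w 0))
    & forall i, (i < N)%N -> 0 < dotp h (w i)].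
Proof.
move=> emb.
have [k kmax] : exists k : 'I_N.+1, forall i : 'I_N.+1, dotp (v i) (v i) <= dotp (v k) (v k).
  case: (@Order.TotalTheory.arg_maxP _ _ 'I_N.+1 ord0 xpredT (fun i => dotp (v i) (v i))) => // k _ hk.
  by exists k => i; exact: hk.
pose v' i := v ((i + k.+1) %% N.+1)%N.
have [emb' set'] := poly_rot k.+1 emb; rewrite -/v' in emb' set'.
have v'N : v' N = v k.
  by rewrite /v' addnS -addSn addnC modnDr modn_small.
pose w i := v' i - v k.
have E i : (i < N.+1)%N -> v' i + - v k = poly_add N w 0 i.
  rewrite /poly_add ltnS leq_eqVlt => /orP[/eqP ->|->//].
  by rewrite ltnn v'N subrr.
exists w, (- v k); split.
- apply: (poly_emb_ext E); apply: poly_embE => // i j u t hi hj hu ht.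
  have pE a x : poly_pieces N.+1 (fun i => v' i + - v k) a x = poly_pieces N.+1 v' a x - v k.
    by rewrite /poly_pieces; vring.
  by rewrite !pE => /addIr; exact: emb'.2.2.2.
- rewrite -(poly_set_ext E) poly_set_translate set'; exact: knot_equiv_translate.
move=> i hi; have : v' i != v k.
  apply/eqP => e; have := emb'.2.2.2 i N 0 0 (leqW hi) (ltnSn N).
  rewrite !poly_pieces0 lexx ltr01 => /(_ isT isT); rewrite v'N => /(_ e)[iN _].
  by rewrite iN ltnn in hi.
have := kmax (Ordinal (ltn_pmod (i + k.+1) (ltn0Sn N))); rewrite /= -/(v' i) /w.
move: (v' i) (v k) => x y; rewrite !dotpE !mxE => le ne.
(* From |x|^2 <= |y|^2 follows |x - y|^2 <= 2 (|y|^2 - x.y), and |y|^2 - x.y is the pairing of [- y]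
   with [x - y]. *)
have : 0 < (cx x - cx y) ^+ 2 + (cy x - cy y) ^+ 2 + (cz x - cz y) ^+ 2.
  rewrite lt_neqAle !addr_ge0 ?sqr_ge0// andbT eq_sym; apply: contra ne.
  rewrite !paddr_eq0 ?addr_ge0 ?sqr_ge0// !expf_eq0 !subr_eq0 /=.
  by move=> /andP[/andP[/eqP h1 /eqP h2] /eqP h3]; apply/eqP; exact: pt_ext.
by rewrite !expr2; lra.
Qed.

(** * Properties valid for all small positive parameters *)

Definition near0 (A : RR -> Prop) := exists2 e, 0 < e & forall t, 0 < t < e -> A t.

Lemma near0_and (A B : RR -> Prop) : near0 A -> near0 B -> near0 (fun t => A t /\ B t).
Proof.
move=> [e e0 he] [f f0 hf]; exists (Num.min e f); first by rewrite lt_min e0.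
by move=> t; rewrite lt_min => /and3P[t0 te tf]; split; [apply: he|apply: hf]; rewrite t0.
Qed.

Lemma near0_forall n (A : nat -> RR -> Prop) : (forall i, (i < n)%N -> near0 (A i)) ->
  near0 (fun t => forall i, (i < n)%N -> A i t).
Proof.
elim: n => [|n IH] h; first by exists 1.
have [||e e0 he] := near0_and (IH _) (h n _) => //.
  by move=> i hi; apply: h; lia.
exists e => // t /he[h1 h2] i; rewrite ltnS leq_eqVlt => /orP[/eqP ->//|]; exact: h1.
Qed.

Lemma near0_imply (P : Prop) (A : RR -> Prop) : (P -> near0 A) -> near0 (fun t => P -> A t).
Proof.
move=> h; have [p|np] := pselect P; last by exists 1.
by have [e e0 he] := h p; exists e => // t /he.
Qed.

Lemma near0_ex (A : RR -> Prop) : near0 A -> exists t, A t.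
Proof. by move=> [e e0 he]; exists (e / 2); apply: he; lra. Qed.

Lemma near0_linear_lt (a b : RR) : a < b -> forall c, near0 (fun t => a + t * c < b).
Proof.
move=> ab c; have c1 : 0 < `|c| + 1 by rewrite ltr_wpDl.
exists ((b - a) / (`|c| + 1)); first by rewrite divr_gt0// subr_gt0.
move=> t /andP[t0]; rewrite ltr_pdivlMr// => h.
have := ler_wpM2l (ltW t0) (ler_norm c); lra.
Qed.

Definition polyfun (f : RR -> RR) := exists p : {poly RR}, forall t, f t = p.[t].

Lemma polyfun_cst c : polyfun (fun=> c).
Proof. by exists c%:P => t; rewrite hornerC. Qed.
Lemma polyfun_id : polyfun id.
Proof. by exists 'X => t; rewrite hornerX. Qed.
Lemma polyfunD f g : polyfun f -> polyfun g -> polyfun (fun t => f t + g t).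
Proof. by move=> [p hp] [q hq]; exists (p + q) => t; rewrite hornerD hp hq. Qed.
Lemma polyfunN f : polyfun f -> polyfun (fun t => - f t).
Proof. by move=> [p hp]; exists (- p) => t; rewrite hornerN hp. Qed.
Lemma polyfunM f g : polyfun f -> polyfun g -> polyfun (fun t => f t * g t).
Proof. by move=> [p hp] [q hq]; exists (p * q) => t; rewrite hornerM hp hq. Qed.

(** The value at 1 only certifies that the polynomial is not zero. *)
Lemma polyfun_near0 f : polyfun f -> f 1 != 0 -> near0 (fun t => f t != 0).
Proof.
move=> [p hp]; rewrite hp => p1.
have [|e e0 he] := @poly_nonzero_near0 p.
  by apply: contraNneq p1 => ->; rewrite horner0.
by exists e => // t /he; rewrite hp.
Qed.

Definition polyvec (f : RR -> pt) :=
  [/\ polyfun (fun t => cx (f t)), polyfun (fun t => cy (f t)) & polyfun (fun t => cz (f t))].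

Lemma polyvec_cross f g : polyvec f -> polyvec g -> polyvec (fun t => crossp (f t) (g t)).
Proof.
move=> [fx fy fz] [gx gy gz]; split; rewrite /crossp.
- under [X in polyfun X]eq_fun do rewrite vecx.
  by apply: polyfunD; [|apply: polyfunN]; exact: polyfunM.
- under [X in polyfun X]eq_fun do rewrite vecy.
  by apply: polyfunD; [|apply: polyfunN]; exact: polyfunM.
- under [X in polyfun X]eq_fun do rewrite vecz.
  by apply: polyfunD; [|apply: polyfunN]; exact: polyfunM.
Qed.

Lemma polyfun_tri f g h : polyvec f -> polyvec g -> polyvec h ->
  polyfun (fun t => tri (f t) (g t) (h t)).
Proof.
move=> pf pg [hx hy hz]; have [cX cY cZ] := polyvec_cross pf pg.
rewrite /tri; under [X in polyfun X]eq_fun do rewrite dotpE.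
by apply: polyfunD; [apply: polyfunD|]; exact: polyfunM.
Qed.

Lemma polyvec_segment (a b : pt) : polyvec (fun t => (1 - t) *: a + t *: b).
Proof.
have h k : polyfun (fun t => ((1 - t) *: a + t *: b) ord0 k).
  under [X in polyfun X]eq_fun do rewrite !mxE.
  apply: polyfunD; apply: polyfunM; try exact: polyfun_cst; last exact: polyfun_id.
  by apply: polyfunD; [exact: polyfun_cst|apply: polyfunN; exact: polyfun_id].
by split; exact: h.
Qed.

(* No three of the directions are coplanar, and no three of the planes spanned
   by consecutive directions contain a common line. *)
Definition generic_dirs N (w : nat -> pt) :=
  (forall i j k, (i < j < k)%N -> (k < N)%N -> tri (w i) (w j) (w k) != 0) /\
  (forall i j k, (i < j < k)%N -> (k.+1 < N)%N ->
     tri (crossp (w i) (w i.+1)) (crossp (w j) (w j.+1)) (crossp (w k) (w k.+1)) != 0).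

Definition moment (i : nat) : pt := vec 1 i%:R (i%:R ^+ 2).

(** The first determinant is Vandermonde's. The cross product of consecutive points is (i (i + 1), -
    (2 i + 1), 1), with entries of degree 2, 1, 0 in i, so the second is twice a Vandermonde
    determinant. *)
Lemma moment_generic N : generic_dirs N moment.
Proof.
split=> i j k /andP[ij jk] hk.
  have -> : tri (moment i) (moment j) (moment k) =
      (j%:R - i%:R) * ((k%:R - i%:R) * (k%:R - j%:R)).
    by rewrite triE /moment !vecE; ring.
  by rewrite !mulf_neq0 ?subr_eq0 ?eqr_nat//; lia.
have -> : tri (crossp (moment i) (moment i.+1)) (crossp (moment j) (moment j.+1))
     (crossp (moment k) (moment k.+1)) =
      2 * ((j%:R - i%:R) * ((k%:R - i%:R) * (k%:R - j%:R))).
  by rewrite triE /crossp /moment !vecE -!natr1; ring.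
rewrite !mulf_neq0 ?oppr_eq0 ?subr_eq0 ?eqr_nat//; lia.
Qed.

(* Along the segment from w to the moment curve each determinant is a polynomial
   which does not vanish at 1, hence does not vanish near 0 except perhaps at 0. *)
Lemma poly_generic N w h : poly_emb N.+1 (poly_add N w 0) ->
  (forall i, (i < N)%N -> 0 < dotp h (w i)) ->
  exists w', [/\ poly_emb N.+1 (poly_add N w' 0),
      knot_equiv (poly_set N.+1 (poly_add N w 0)) (poly_set N.+1 (poly_add N w' 0)),
      (forall i, (i < N)%N -> 0 < dotp h (w' i)) & generic_dirs N w'].
Proof.
move=> emb hpos; have [e e0 he] := poly_stable emb.
pose W t i := (1 - t) *: w i + t *: moment i.
have W1 : W 1 = moment by apply/funext => i; rewrite /W subrr scale0r add0r scale1r.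
have [gm1 gm2] := moment_generic N.
have n1 : near0 (fun t => forall i, (i < N)%N -> 0 < dotp h (W t i)).
  apply: near0_forall => i hi.
  have [|d d0 hd] := @near0_linear_lt (- dotp h (w i)) 0 _ (dotp h (w i) - dotp h (moment i)).
    by rewrite oppr_lt0 hpos.
  by exists d => // t /hd; rewrite /W !dotpE !mxE; lra.
have n2 : near0 (fun t => forall i, (i < N)%N -> `|W t i - w i| < e).
  apply: near0_forall => i hi.
  have [d d0 hd] := near0_linear_lt e0 `|moment i - w i|.
  exists d => // t ht; have := hd _ ht; rewrite add0r.
  have -> : W t i - w i = t *: (moment i - w i) by rewrite /W; vring.
  by rewrite normrZ gtr0_norm//; case/andP: ht.
have n3 : near0 (fun t => forall k, (k < N)%N -> forall j, (j < N)%N -> forall i, (i < N)%N ->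
     (i < j < k)%N -> tri (W t i) (W t j) (W t k) != 0).
  do 3 (apply: near0_forall => ? ?); apply: near0_imply => ijk.
  apply: polyfun_near0; last by rewrite W1 gm1.
  by apply: polyfun_tri; exact: polyvec_segment.
have n4 : near0 (fun t => forall k, (k < N)%N -> forall j, (j < N)%N -> forall i, (i < N)%N ->
     (i < j < k)%N /\ (k.+1 < N)%N -> tri (crossp (W t i) (W t i.+1))
       (crossp (W t j) (W t j.+1)) (crossp (W t k) (W t k.+1)) != 0).
  do 3 (apply: near0_forall => ? ?); apply: near0_imply => -[ijk kN].
  apply: polyfun_near0; last by rewrite W1 gm2.
  by apply: polyfun_tri; apply: polyvec_cross; exact: polyvec_segment.
have [t [h1 [h2 [h3 h4]]]] := near0_ex (near0_and n1 (near0_and n2 (near0_and n3 n4))).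
exists (W t); have [|emb' eqv] := he (poly_add N (W t) 0).
  by move=> i _; rewrite /poly_add; case: ifP => [/h2//|_]; rewrite subrr normr0.
split=> //; split=> i j k ijk hk.
  by apply: h3 => //; lia.
by apply: h4 => //; lia.
Qed.

(** * Great circle arcs *)

Lemma coordD (u v : pt) k : (u + v) ord0 k = u ord0 k + v ord0 k.
Proof. by rewrite mxE. Qed.
Lemma coordN (u : pt) k : (- u) ord0 k = - u ord0 k.
Proof. by rewrite mxE. Qed.
Lemma coordZ (u : pt) c k : (c *: u) ord0 k = c * u ord0 k.
Proof. by rewrite mxE. Qed.
Lemma coord0 k : (0 : pt) ord0 k = 0.
Proof. by rewrite mxE. Qed.
Lemma crossp_x u v : cx (crossp u v) = cy u * cz v - cz u * cy v.
Proof. exact: vecx. Qed.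
Lemma crossp_y u v : cy (crossp u v) = cz u * cx v - cx u * cz v.
Proof. exact: vecy. Qed.
Lemma crossp_z u v : cz (crossp u v) = cx u * cy v - cy u * cx v.
Proof. exact: vecz. Qed.
Definition coordE := (coordD, coordN, coordZ, coord0, crossp_x, crossp_y, crossp_z).
Ltac pring := rewrite ?triE ?dotpE; rewrite ?coordE; rewrite ?dotpE ?coordE; ring.

Lemma dotpC u v : dotp u v = dotp v u.
Proof. by pring. Qed.
Lemma dotpDr u v w : dotp u (v + w) = dotp u v + dotp u w.
Proof. by pring. Qed.
Lemma dotpZr u c v : dotp u (c *: v) = c * dotp u v.
Proof. by pring. Qed.
Lemma dotpDl u v w : dotp (u + v) w = dotp u w + dotp v w.
Proof. by pring. Qed.
Lemma dotpZl u c v : dotp (c *: u) v = c * dotp u v.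
Proof. by pring. Qed.
Definition dotp_lin := (dotpDr, dotpZr, dotpDl, dotpZl).

Lemma dotp_eq0 u : (dotp u u == 0) = (u == 0).
Proof.
apply/eqP/eqP => [|->]; last by rewrite dotpE !mxE !mul0r !addr0.
rewrite dotpE -!expr2 => /eqP.
rewrite !paddr_eq0 ?addr_ge0 ?sqr_ge0// !expf_eq0 /= => /andP[/andP[/eqP h1 /eqP h2] /eqP h3].
by apply: pt_ext; rewrite mxE.
Qed.

Lemma dotp_gt0 u : (0 < dotp u u) = (u != 0).
Proof.
rewrite lt_neqAle eq_sym dotp_eq0; case: eqP => //= _.
by rewrite dotpE -!expr2 !addr_ge0 ?sqr_ge0.
Qed.

Lemma crossp_crossp a b c : crossp (crossp a b) c = dotp a c *: b - dotp b c *: a.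
Proof. by apply: pt_ext; pring. Qed.

Lemma dotp_crossp a b c d : dotp (crossp a b) (crossp c d) = dotp a c * dotp b d - dotp a d * dotp b c.
Proof. by pring. Qed.

Lemma dotp_crossp_l a b : dotp (crossp a b) a = 0.
Proof. by pring. Qed.
Lemma dotp_crossp_r a b : dotp (crossp a b) b = 0.
Proof. by pring. Qed.

Lemma tri_orthogonal a b c x : tri a b c != 0 ->
  dotp a x = 0 -> dotp b x = 0 -> dotp c x = 0 -> x = 0.
Proof.
move=> ne ha hb hc.
have E : tri a b c *: x = dotp a x *: crossp b c + dotp b x *: crossp c a + dotp c x *: crossp a b.
  by apply: pt_ext; pring.
by apply: (scalerI ne); rewrite E ha hb hc !scale0r !addr0 scaler0.
Qed.

(** Both [n] and [m] are multiples of [crossp x y]. *)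
Lemma crossp_orthogonal n m x y : crossp x y != 0 ->
  dotp n x = 0 -> dotp n y = 0 -> dotp m x = 0 -> dotp m y = 0 -> crossp n m = 0.
Proof.
move=> ne nx ny mx my.
have c0 : dotp (crossp x y) (crossp x y) != 0 by rewrite dotp_eq0.
have nE : dotp (crossp x y) (crossp x y) *: n = dotp (crossp x y) n *: crossp x y.
  have : crossp (crossp (crossp x y) n) (crossp x y) = 0.
    by rewrite (crossp_crossp x) (dotpC x) (dotpC y) nx ny !scale0r subrr; apply: pt_ext; pring.
  by rewrite crossp_crossp (dotpC n) => /eqP; rewrite subr_eq0 => /eqP.
have mE : crossp (crossp x y) m = 0.
  by rewrite crossp_crossp (dotpC x) (dotpC y) mx my !scale0r subrr.
apply: (scalerI c0); rewrite scaler0.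
transitivity (crossp (dotp (crossp x y) (crossp x y) *: n) m).
  by apply: pt_ext; pring.
rewrite nE; transitivity (dotp (crossp x y) n *: crossp (crossp x y) m).
  by apply: pt_ext; pring.
by rewrite mE scaler0.
Qed.

Definition orthonormal (P Q : pt) := [/\ dotp P P = 1, dotp Q Q = 1 & dotp P Q = 0].

Definition circ (P Q : pt) (t : RR) : pt := cos t *: P + sin t *: Q.

Lemma gen_cos_lt1 (R : realType) (x : R) : 0 < x < 2 * pi -> cos x < 1.
Proof.
move=> /andP[x0 x1]; have -> : x = x / 2 + x / 2 by field.
rewrite trigo.cosD -!expr2 cos2sin2.
have : 0 < sin (x / 2) by apply: sin_gt0_pi; rewrite divr_gt0//= ltr_pdivrMr// mulrC.
by move=> s; have := exprn_gt0 2 s; lra.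
Qed.

Lemma cos_lt1 (x : RR) : 0 < x < 2 * pi -> cos x < 1.
Proof. exact: gen_cos_lt1. Qed.

Lemma circ_dotp P Q s t : orthonormal P Q -> dotp (circ P Q s) (circ P Q t) = cos (s - t).
Proof.
move=> [h1 h2 h3]; rewrite trigo.cosB /circ !dotp_lin (dotpC Q P) h1 h2 h3; ring.
Qed.

(** Two points of a great circle have inner product the cosine of their angular difference, which is
    below 1 strictly inside a full turn. *)
Lemma circ_inj P Q s t : orthonormal P Q -> `|s - t| < 2 * pi -> circ P Q s = circ P Q t -> s = t.
Proof.
move=> on; wlog le : s t / t <= s.
  move=> h st E; have [le|/ltW le] := leP t s; first exact: h.
  by apply/esym; apply: h; rewrite 1?distrC.
rewrite ger0_norm ?subr_ge0// => st E; apply/eqP; apply: contraT => ne.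
have : cos (s - t) < 1.
  by apply: cos_lt1; rewrite st andbT subr_gt0 lt_neqAle eq_sym ne.
by rewrite -(circ_dotp _ _ on) E (circ_dotp _ _ on) subrr cos0 ltxx.
Qed.

Lemma circ_unit P Q t : orthonormal P Q -> dotp (circ P Q t) (circ P Q t) = 1.
Proof. by move=> on; rewrite circ_dotp// subrr cos0. Qed.

Lemma circ_neq0 P Q t : orthonormal P Q -> circ P Q t != 0.
Proof. by move=> on; rewrite -dotp_eq0 circ_unit// oner_eq0. Qed.

Lemma dotp_circ n P Q t : dotp n P = 0 -> dotp n Q = 0 -> dotp n (circ P Q t) = 0.
Proof. by move=> h1 h2; rewrite /circ !dotp_lin h1 h2 !mulr0 addr0. Qed.

(* An endpoint of an arc lies in the planes of the two arcs that meet there, so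
   the condition on triples also keeps arc endpoints off the other arcs. *)
Lemma sph_curve_of_normals m (P Q : nat -> pt) (Th : nat -> RR) (n : nat -> pt) :
  (1 < m)%N ->
  (forall i, (i < m)%N -> [/\ orthonormal (P i) (Q i), 0 < Th i < 2 * pi,
      dotp (n i) (P i) = 0 & dotp (n i) (Q i) = 0]) ->
  (forall i, (i < m)%N -> circ (P i) (Q i) (Th i) = P (cyc_next m i)) ->
  (forall i j k, (i < m)%N -> (j < m)%N -> (k < m)%N -> i <> j -> j <> k -> i <> k ->
     tri (n i) (n j) (n k) != 0) ->
  (forall i j, (i < m)%N -> (j < m)%N -> i <> j -> crossp (n i) (n j) != 0) ->
  sph_stick_curve m P Q Th.
Proof.
move=> m1 data closing gen3 gen2.
have m0 : (0 < m)%N by lia.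
have on i (hi : (i < m)%N) : orthonormal (P i) (Q i) by have [] := data i hi.
have cE i u : sph_pieces P Q Th i u = circ (P i) (Q i) (u * Th i) by [].
have c0 i : sph_pieces P Q Th i 0 = P i.
  by rewrite cE mul0r /circ cos0 sin0 scale1r scale0r addr0.
have cclose i : (i < m)%N -> sph_pieces P Q Th i 1 = sph_pieces P Q Th (cyc_next m i) 0.
  by move=> hi; rewrite c0 cE mul1r closing.
have nc i u (hi : (i < m)%N) : dotp (n i) (sph_pieces P Q Th i u) = 0.
  by have [_ _ h1 h2] := data i hi; exact: dotp_circ.
have nz i u (hi : (i < m)%N) : sph_pieces P Q Th i u <> 0.
  by move/eqP; apply/negP; exact/circ_neq0/on.
have inj i u w (hi : (i < m)%N) : 0 <= u <= 1 -> 0 <= w <= 1 ->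
    sph_pieces P Q Th i u = sph_pieces P Q Th i w -> u = w.
  move=> hu hw; have [oi /andP[t0 t1] _ _] := data i hi.
  rewrite !cE => /(circ_inj oi) E.
  apply: (mulIf (lt0r_neq0 t0)); apply: E; rewrite -mulrBl normrM (gtr0_norm t0).
  apply: le_lt_trans t1; apply: ler_piMl; [exact: ltW|rewrite ler_norml; lra].
(* A point on three arcs would be orthogonal to three independent normals. *)
have trip i j k u w z : (i < m)%N -> (j < m)%N -> (k < m)%N -> i <> j -> j <> k -> i <> k ->
    sph_pieces P Q Th i u = sph_pieces P Q Th j w ->
    sph_pieces P Q Th i u = sph_pieces P Q Th k z -> False.
  move=> hi hj hk ij jk ik Ej Ek; apply: (nz i u hi).
  apply: (tri_orthogonal (gen3 i j k hi hj hk ij jk ik)); first exact: nc.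
    by rewrite Ej nc.
  by rewrite Ek nc.
(* If [u = 0], the point is also the end of the previous arc [p]: for [j] other than [p] it lies on
   three arcs, and for [j = p] injectivity gives [w = 1]. *)
have pos i j u w : (i < m)%N -> (j < m)%N -> 0 <= u < 1 -> 0 <= w < 1 -> i <> j ->
    sph_pieces P Q Th i u = sph_pieces P Q Th j w -> 0 < u.
  move=> hi hj hu hw ij E; rewrite lt_neqAle eq_sym; case/andP: (hu) => -> _; rewrite andbT.
  apply/eqP => u0; rewrite u0 in E.
  have [p hp pi] : exists2 p, (p < m)%N & cyc_next m p = i.
    case: i hi {ij E} => [|i] hi.
      by exists m.-1; [lia|rewrite cyc_nextE ?ifT//; lia].
    by exists i; [lia|rewrite cyc_nextE ?ifN//; lia].
  have Ep : sph_pieces P Q Th i 0 = sph_pieces P Q Th p 1 by rewrite cclose// pi.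
  have pi' : i <> p by move=> ip; move: pi; rewrite -ip cyc_nextE//; case: eqP; lia.
  have [jp|jp] := eqVneq j p; last first.
    by apply: (trip i j p 0 w 1) => //; apply/eqP; rewrite // eq_sym.
  rewrite jp in E; have w1 : w = 1 by apply: (inj p) => //; [lra|lra|rewrite -E Ep].
  by lra.
split=> //; split.
  by move=> i hi; have [[h1 h2 h3] h4 _ _] := data i hi.
split=> // i j u w hi hj hu hw ne E.
have ij : i <> j.
  move=> ij; apply: ne; rewrite -ij in E *; congr pair; apply: (inj i) => //; lra.
have u0 := pos i j u w hi hj hu hw ij E.
have w0 := pos j i w u hj hi hw hu (nesym ij) (esym E).
split=> //.
(* Parallel tangents at a common point would put both arcs in one plane and make the normals
   parallel. *)
- move=> a Ta.
  have TE k z : sph_tangent P Q Th k z = circ (Q k) (- P k) (z * Th k).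
    by rewrite /sph_tangent /circ scaleNr scalerN addrC.
  have oT k : (k < m)%N -> orthonormal (Q k) (- P k).
    move=> /on[h1 h2 h3]; rewrite -scaleN1r; split=> //; rewrite !dotp_lin ?h1 ?(dotpC (Q k)) ?h3; ring.
  have nT k z (hk : (k < m)%N) : dotp (n k) (sph_tangent P Q Th k z) = 0.
    have [_ _ h1 h2] := data k hk; rewrite TE; apply: dotp_circ => //.
    by rewrite -scaleN1r dotpZr h1 mulr0.
  have a0 : a != 0.
    apply/eqP => a0; have := circ_neq0 (w * Th j) (oT j hj).
    by rewrite -TE Ta a0 scale0r eqxx.
  have := gen2 i j hi hj ij;
  rewrite (@crossp_orthogonal _ _ (sph_pieces P Q Th i u) (sph_tangent P Q Th i u)) ?eqxx//.
  + have [h1 h2 h3] := on i hi.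
    set x := sph_pieces P Q Th i u; set y := sph_tangent P Q Th i u.
    have xx : dotp x x = 1 by apply: circ_unit; exact: on.
    have yy : dotp y y = 1 by rewrite /y TE; apply: circ_unit; exact: oT.
    have xy : dotp x y = 0.
      by rewrite /x /y /sph_tangent /sph_pieces !dotp_lin h1 h2 (dotpC (Q i)) h3; ring.
    by rewrite -dotp_eq0 dotp_crossp xx yy xy mul0r subr0 mulr1 oner_eq0.
  + exact: nc.
  + exact: nT.
  + by rewrite E nc.
  + by apply: (mulfI a0); rewrite mulr0 -dotpZr -Ta nT.
- move=> k z hk hz Ek.
  have [ki|/eqP ki] := eqVneq k i.
    by left; rewrite ki in Ek *; congr pair; apply: (inj i) => //; lra.
  have [kj|/eqP kj] := eqVneq k j.
    by right; rewrite kj E in Ek *; congr pair; apply: (inj j) => //; lra.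
  exfalso; apply: (trip i j k u w z) => //; exact: nesym.
Qed.

(** * Radial lifts of polygonal paths *)

(** An oriented orthonormal basis of the plane orthogonal to [n]: the direction of [n] fixes the
    sense in which angles increase, and its length is free. *)
Definition frame (n P Q : pt) := orthonormal P Q /\ exists2 c : RR, 0 < c & n = c *: crossp P Q.

Lemma frame_orthogonal n P Q : frame n P Q -> dotp n P = 0 /\ dotp n Q = 0.
Proof.
move=> [_ [c _ ->]]; rewrite !dotpZl dotp_crossp_l dotp_crossp_r mulr0.
by split.
Qed.

Lemma frame_coord n P Q b : frame n P Q -> dotp n b = 0 ->
  b = dotp b P *: P + dotp b Q *: Q.
Proof.
move=> [[h1 h2 h3] [c c0 ->]]; rewrite dotpZl => /eqP.
rewrite mulf_eq0 gt_eqF//= => /eqP bk.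
have E : crossp (crossp P Q) (crossp (crossp P Q) b) = - b.
  have -> : crossp (crossp P Q) (crossp (crossp P Q) b) =
     - crossp (crossp (crossp P Q) b) (crossp P Q) by apply: pt_ext; pring.
  rewrite crossp_crossp dotp_crossp h1 h2 h3 (dotpC b) bk (dotpC Q) h3.
  by rewrite mulr0 subr0 mulr1 scale1r scale0r subr0.
rewrite -[LHS]opprK -E [crossp (crossp P Q) b]crossp_crossp.
have -> : crossp (crossp P Q) (dotp P b *: Q - dotp Q b *: P) =
   dotp P b *: crossp (crossp P Q) Q - dotp Q b *: crossp (crossp P Q) P.
  by apply: pt_ext; pring.
rewrite !crossp_crossp h1 h2 h3 (dotpC Q P) h3 (dotpC P b) (dotpC Q b).
by apply: pt_ext; rewrite !coordE; ring.
Qed.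

Lemma frame_exists n a : a != 0 -> n != 0 -> dotp n a = 0 ->
  exists P Q (r : RR), [/\ frame n P Q, 0 < r & a = r *: P].
Proof.
move=> a0 n0 na.
have norm1 (u : pt) : u != 0 -> exists (r : RR) (v : pt), [/\ 0 < r, u = r *: v & dotp v v = 1].
  move=> u0; have d0 : 0 < dotp u u by rewrite dotp_gt0.
  have r0 : 0 < Num.sqrt (dotp u u) by rewrite sqrtr_gt0.
  exists (Num.sqrt (dotp u u)), ((Num.sqrt (dotp u u))^-1 *: u); split=> //.
    by rewrite scalerA mulfV ?scale1r// lt0r_neq0.
  rewrite !dotp_lin -[X in _ * (_ * X)]sqr_sqrtr ?ltW// expr2.
  by field; exact: lt0r_neq0.
have [r [P [r0 aE PP]]] := norm1 a a0.
have [c [k [c0 nE kk]]] := norm1 n n0.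
have kP : dotp k P = 0.
  move/eqP: na; rewrite aE nE !dotp_lin !mulf_eq0 (gt_eqF r0) (gt_eqF c0) /=.
  by move=> /eqP.
exists P, (crossp k P), r; split=> //; split.
  split=> //; first by rewrite dotp_crossp kk PP kP mul0r mulr1 subr0.
  by rewrite dotpC dotp_crossp_r.
exists c => //; rewrite nE; congr (_ *: _).
have -> : crossp P (crossp k P) = - crossp (crossp k P) P by apply: pt_ext; pring.
by rewrite crossp_crossp kP PP scale0r scale1r sub0r opprK.
Qed.

(** In the plane of the frame, the sign of [tri _ _ n] is that of a 2 by 2 determinant: positive
    means a counterclockwise turn by less than pi. *)
Lemma frame_tri n P Q : frame n P Q -> exists2 c : RR, 0 < c &
  forall x y z t : RR, tri (x *: P + y *: Q) (z *: P + t *: Q) n = c * (x * t - y * z).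
Proof.
move=> [[h1 h2 h3] [c c0 ->]]; exists c => // x y z t.
rewrite /tri dotpZr dotp_crossp !dotp_lin h1 h2 h3 (dotpC Q P) h3; ring.
Qed.

Lemma gen_angle_upper (R : realType) (x y : R) : 0 < y -> exists r t,
  [/\ 0 < r, 0 < t < pi, x = r * cos t & y = r * sin t].
Proof.
move=> y0; pose r := Num.sqrt (x ^+ 2 + y ^+ 2).
have y2 : 0 < y ^+ 2 by rewrite exprn_gt0.
have x2 := sqr_ge0 x.
have s0 : 0 < x ^+ 2 + y ^+ 2 by rewrite ltr_wpDl.
have r0 : 0 < r by rewrite sqrtr_gt0.
have r2 : r ^+ 2 = x ^+ 2 + y ^+ 2 by rewrite sqr_sqrtr// ltW.
have xr : x ^+ 2 < r ^+ 2 by rewrite r2 ltrDl.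
have xr1 : -1 < x / r < 1.
  rewrite ltr_pdivlMr// ltr_pdivrMr// mulN1r mul1r -ltr_norml.
  by rewrite -ltr_sqr ?nnegrE ?(ltW r0)// real_normK ?num_real.
have [xr2 xr3] := andP xr1.
exists r, (acos (x / r)); split=> //.
- have h : -1 <= x / r <= 1 by rewrite !ltW.
  by rewrite acos_gt0 ?(ltW xr2)// acos_ltpi// (ltW xr3) andbT.
- by rewrite acosK ?in_itv/= ?ltW// mulrC divfK// lt0r_neq0.
- rewrite sin_acos ?ltW//.
  have -> : 1 - (x / r) ^+ 2 = (y / r) ^+ 2.
    by rewrite !expr_div_n r2; field; exact: lt0r_neq0.
  by rewrite sqrtr_sqr ger0_norm ?divr_ge0 ?ltW// mulrC divfK// lt0r_neq0.
Qed.

Lemma angle_upper (x y : RR) : 0 < y -> exists r t,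
  [/\ 0 < r, 0 < t < pi, x = r * cos t & y = r * sin t].
Proof. exact: gen_angle_upper. Qed.

(** Rotating [b] back by the angle [s] puts it in the open upper half-plane, where the polar angle
    lies strictly between 0 and pi. *)
Lemma angle_step n P Q s r b : frame n P Q -> 0 < r -> dotp n b = 0 ->
  0 < tri (r *: circ P Q s) b n ->
  exists r' t, [/\ 0 < r', 0 < t < pi & b = r' *: circ P Q (s + t)].
Proof.
move=> fr r0 nb; have bE := frame_coord fr nb.
have [c c0 triE'] := frame_tri fr; rewrite bE.
move: (dotp b P) (dotp b Q) => x y.
have -> : r *: circ P Q s = (r * cos s) *: P + (r * sin s) *: Q.
  by rewrite /circ scalerDr !scalerA.
rewrite triE' => h.
have h' : 0 < y * cos s - x * sin s.
  move: h; rewrite pmulr_rgt0//.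
  have -> : r * cos s * y - r * sin s * x = r * (y * cos s - x * sin s) by ring.
  by rewrite pmulr_rgt0.
have [r' [t [r'0 t0 e1 e2]]] := angle_upper (x * cos s + y * sin s) h'.
exists r', t; split=> //.
rewrite /circ trigo.cosD trigo.sinD.
have -> : r' *: ((cos s * cos t - sin s * sin t) *: P + (sin s * cos t + cos s * sin t) *: Q) =
   ((r' * cos t) * cos s - (r' * sin t) * sin s) *: P + ((r' * cos t) * sin s + (r' * sin t) * cos s) *: Q.
  by apply: pt_ext; rewrite !coordE; ring.
rewrite -e1 -e2; have cs := cos2Dsin2 s.
congr (_ *: _ + _ *: _).
- transitivity (x * (cos s ^+ 2 + sin s ^+ 2)); first by rewrite cs mulr1.
  by ring.
- transitivity (y * (cos s ^+ 2 + sin s ^+ 2)); first by rewrite cs mulr1.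
  by ring.
Qed.

Definition segment (a b : pt) : set pt := [set (1 - u) *: a + u *: b | u in [set u : RR | 0 <= u <= 1]].

(** [X] is a radial graph over the angles from [s] to [t]. The radius is continuous on the whole
    line, so that lifts can be glued and reparametrized by plain composition. *)
Definition arc_lift (P Q : pt) (s t : RR) (a b : pt) (X : set pt) := exists rho : RR -> RR,
  [/\ continuous rho, (forall x, s <= x <= t -> 0 < rho x),
      rho s *: circ P Q s = a, rho t *: circ P Q t = b
    & X = [set rho x *: circ P Q x | x in [set x | s <= x <= t]]].

Lemma arc_lift_cat P Q s t u a b c X Y : s <= t -> t <= u -> circ P Q t != 0 ->
  arc_lift P Q s t a b X -> arc_lift P Q t u b c Y -> arc_lift P Q s u a c (X `|` Y).
Proof.
move=> st tu ct [f [cf f0 fs ft ->]] [g [cg g0 gt gu ->]].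
have fg : f t = g t.
  apply/eqP; have := eqxx b; rewrite -{1}ft -{1}gt -subr_eq0 -scalerBl scaler_eq0 (negbTE ct) orbF.
  by rewrite subr_eq0.
(* Left of [t] the second term is 0, right of [t] the first is the constant [f t = g t]; continuity
   needs no case distinction. *)
pose h x := f (Num.min x t) + (g (Num.max x t) - g t).
have hl x : x <= t -> h x = f x.
  by move=> xt; rewrite /h min_l// max_r// subrr addr0.
have hr x : t <= x -> h x = g x.
  by move=> tx; rewrite /h min_r// max_l// fg addrC subrK.
exists h; split.
- move=> x; apply: (@continuousDr RR (fun x => f (Num.min x t)) (fun x => g (Num.max x t) - g t)).
    apply: (@continuous_comp _ _ _ (fun x => Num.min x t) f); last exact: cf.
    by apply: (@continuous_minr RR id (fun=> t)); [exact: cvg_id|exact: cst_continuous].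
  apply: (@continuousDr RR _ (fun=> - g t)); last exact: cst_continuous.
  apply: (@continuous_comp _ _ _ (fun x => Num.max x t) g); last exact: cg.
  by apply: (@continuous_maxr RR id (fun=> t)); [exact: cvg_id|exact: cst_continuous].
- move=> x /andP[sx xu]; have [xt|tx] := leP x t; first by rewrite hl// f0// sx.
  by rewrite hr ?(ltW tx)// g0// ltW.
- by rewrite hl.
- by rewrite hr.
apply/seteqP; split.
  move=> _ [[x /= /andP[sx xt] <-]|[x /= /andP[tx xu] <-]].
    by exists x; rewrite ?hl//= sx (le_trans xt).
  by exists x; rewrite ?hr//= xu (le_trans st).
move=> _ [x /= /andP[sx xu] <-]; have [xt|tx] := leP x t.
  by left; exists x; rewrite ?hl//= sx.
by right; exists x; rewrite ?hr ?(ltW tx)//= (ltW tx).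
Qed.

Lemma gen_ivt01 (R : realType) (f : R -> R) (s t v : R) : s <= t -> continuous f ->
  f s = 0 -> f t = 1 -> 0 <= v <= 1 -> exists2 x, s <= x <= t & f x = v.
Proof.
move=> st cf fs ft v01; have [||x] := @IVT R f s t v st.
- exact: continuous_subspaceT.
- by rewrite fs ft min_l// max_r.
- by rewrite in_itv => hx <-; exists x.
Qed.

Lemma ivt01 (f : RR -> RR) (s t v : RR) : s <= t -> continuous f ->
  f s = 0 -> f t = 1 -> 0 <= v <= 1 -> exists2 x, s <= x <= t & f x = v.
Proof. exact: gen_ivt01. Qed.

Lemma gen_sin_combination_gt0 (R : realType) (a b s t x : R) : 0 < a -> 0 < b -> s < t -> t < s + pi ->
  s <= x <= t -> 0 < a * sin (x - s) + b * sin (t - x).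
Proof.
move=> a0 b0 st ts /andP[sx xt].
have h1 : 0 <= sin (x - s) by apply: sin_ge0_pi; lra.
have h2 : 0 <= sin (t - x) by apply: sin_ge0_pi; lra.
have [xs|xs] := eqVneq x s.
  have : 0 < sin (t - x) by apply: sin_gt0_pi; lra.
  by move=> h; rewrite ltr_wpDl// ?mulr_ge0 ?mulr_gt0 ?(ltW a0).
have xs' : s < x by rewrite lt_neqAle eq_sym xs.
have : 0 < sin (x - s) by apply: sin_gt0_pi; lra.
by move=> h; rewrite ltr_wpDr// ?mulr_ge0 ?mulr_gt0 ?(ltW b0).
Qed.

Lemma sin_combination_gt0 (a b s t x : RR) : 0 < a -> 0 < b -> s < t -> t < s + pi ->
  s <= x <= t -> 0 < a * sin (x - s) + b * sin (t - x).
Proof. exact: gen_sin_combination_gt0. Qed.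

Lemma gen_sin_lt_pi_gt0 (R : realType) (x : R) : 0 < x -> x < pi -> 0 < sin x.
Proof. by move=> x0 x1; apply: sin_gt0_pi; rewrite x0. Qed.

Lemma sin_lt_pi_gt0 (x : RR) : 0 < x -> x < pi -> 0 < sin x.
Proof. exact: gen_sin_lt_pi_gt0. Qed.

(* The polar equation of the line through the points of polar coordinates
   (a, s) and (b, t). *)
Lemma arc_lift_segment P Q (a b s t : RR) : 0 < a -> 0 < b -> s < t -> t < s + pi ->
  arc_lift P Q s t (a *: circ P Q s) (b *: circ P Q t)
    (segment (a *: circ P Q s) (b *: circ P Q t)).
Proof.
move=> a0 b0 st ts.
pose D x := a * sin (x - s) + b * sin (t - x).
(* [D] has zeros outside [s, t]; clamping the angle keeps the radius continuous on the whole
   line. *)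
pose k x := Num.min t (Num.max s x).
have kE x : s <= x <= t -> k x = x.
  by move=> /andP[sx xt]; rewrite /k max_r// min_r.
have kst x : s <= k x <= t.
  by rewrite /k le_min !ge_min lexx le_max lexx (ltW st).
have D0 x : 0 < D (k x) by apply: sin_combination_gt0.
have ck : continuous k.
  move=> x; apply: (@continuous_minr RR (fun=> t)); first exact: cst_continuous.
  by apply: (@continuous_maxr RR (fun=> s) id); [exact: cst_continuous|exact: cvg_id].
have cs1 : continuous (fun x => a * sin (k x - s)).
  move=> x; apply: (@continuousMr RR (fun=> a)); first exact: cst_continuous.
  apply: (@continuous_sinr RR); apply: (@continuousDr RR k (fun=> - s)); [exact: ck|exact: cst_continuous].
have cD : continuous (fun x => D (k x)).
  move=> x; apply: (@continuousDr RR (fun x => a * sin (k x - s)) (fun x => b * sin (t - k x))).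
    exact: cs1.
  apply: (@continuousMr RR (fun=> b)); first exact: cst_continuous.
  apply: (@continuous_sinr RR); apply: (@continuousDr RR (fun=> t)); first exact: cst_continuous.
  by apply: (@continuousNr RR k); exact: ck.
have cVD : continuous (fun x => (D (k x))^-1).
  by move=> x; apply: (@continuousVr RR (fun x => D (k x))); [exact: lt0r_neq0|exact: cD].
have sts : 0 < sin (t - s) by apply: sin_lt_pi_gt0; lra.
have abs : 0 < a * b * sin (t - s) by rewrite !mulr_gt0.
have circE x : sin (t - s) *: circ P Q x = sin (t - x) *: circ P Q s + sin (x - s) *: circ P Q t.
  rewrite /circ !trigo.sinB; have c1 := cos2Dsin2 x.
  have [-> ->] : cos s = (cos x ^+ 2 + sin x ^+ 2) * cos s /\ sin s = (cos x ^+ 2 + sin x ^+ 2) * sin s.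
    by rewrite c1 !mul1r.
  by apply: pt_ext; rewrite !coordE; ring.
(* The point of the segment in direction [x] has parameter [a * sin (x - s) / D x], which goes
   continuously from 0 to 1, so every point of the segment is attained. *)
have key' x : s <= x <= t -> a * b * sin (t - s) / D x *: circ P Q x =
    (1 - a * sin (x - s) / D x) *: (a *: circ P Q s) + (a * sin (x - s) / D x) *: (b *: circ P Q t).
  move=> hx; have Dx : D x != 0 by rewrite -(kE x hx) lt0r_neq0.
  have -> : a * b * sin (t - s) / D x = a * b / D x * sin (t - s) by field.
  rewrite -scalerA circE; move: Dx; rewrite /D.
  move: (circ P Q s) (circ P Q t) (sin (t - x)) (sin (x - s)) => A B u v Dx.
  by apply: pt_ext; rewrite !coordE; field.
have Ds : D s = b * sin (t - s) by rewrite /D subrr sin0 mulr0 add0r.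
have Dt : D t = a * sin (t - s) by rewrite /D subrr sin0 mulr0 addr0.
have ss : s <= s <= t by rewrite lexx ltW.
have tt : s <= t <= t by rewrite lexx ltW.
exists (fun x => a * b * sin (t - s) / D (k x)); split.
- by move=> x; apply: (@continuousMr RR (fun=> _) (fun x => (D (k x))^-1));
    [exact: cst_continuous|exact: cVD].
- by move=> x _; rewrite divr_gt0.
- by rewrite kE// Ds; congr (_ *: _); field; rewrite !lt0r_neq0.
- by rewrite kE// Dt; congr (_ *: _); field; rewrite !lt0r_neq0.
apply/seteqP; split.
  move=> _ [v v01 <-].
  have [|||x hx xv] := @ivt01 (fun x => a * sin (k x - s) / D (k x)) s t v (ltW st) _ _ _ v01.
  - by move=> x; apply: (@continuousMr RR (fun x => a * sin (k x - s)) (fun x => (D (k x))^-1));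
      [exact: cs1|exact: cVD].
  - by rewrite kE// subrr sin0 mulr0 mul0r.
  - by rewrite kE// Dt divff// lt0r_neq0// mulr_gt0.
  exists x => //=; rewrite kE// key'//.
  by move: xv; rewrite kE// => ->.
move=> _ [x /= hx <-]; rewrite kE// key'//.
exists (a * sin (x - s) / D x) => //=.
have Dx := D0 x; rewrite kE// in Dx.
have [sx xt] := andP hx.
have h1 : 0 <= sin (x - s).
  have [->|xs] := eqVneq x s; first by rewrite subrr sin0.
  by apply/ltW/sin_lt_pi_gt0; [rewrite subr_gt0 lt_neqAle eq_sym xs|lra].
have h2 : 0 <= sin (t - x).
  have [->|xs] := eqVneq x t; first by rewrite subrr sin0.
  by apply/ltW/sin_lt_pi_gt0; [rewrite subr_gt0 lt_neqAle xs|lra].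
rewrite ler_pdivrMr// mul1r divr_ge0 ?mulr_ge0 ?(ltW a0) ?(ltW Dx)//=.
by rewrite /D lerDl mulr_ge0 ?(ltW b0).
Qed.

(** * Lifts over a single great circle arc *)

Definition sph_lift_by (n a b : pt) (X : set pt) (P Q : pt) (Th : RR) (rho : RR -> RR) :=
  [/\ orthonormal P Q, 0 < Th < 2 * pi, dotp n P = 0, dotp n Q = 0
    & [/\ continuous rho, (forall u, 0 <= u <= 1 -> 0 < rho u), rho 0 *: P = a,
          rho 1 *: circ P Q Th = b
        & X = [set rho u *: circ P Q (u * Th) | u in [set u | 0 <= u <= 1]]]].

Definition sph_lift n a b X := exists P Q Th rho, sph_lift_by n a b X P Q Th rho.

Lemma circ0 P Q : circ P Q 0 = P.
Proof. by rewrite /circ cos0 sin0 scale1r scale0r addr0. Qed.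

Lemma circ_pi P Q : circ P Q pi = - P.
Proof. by rewrite /circ cospi sinpi scale0r addr0 scaleN1r. Qed.

Lemma arc_sph_lift n P Q Th a b X : frame n P Q -> 0 < Th < 2 * pi ->
  arc_lift P Q 0 Th a b X -> sph_lift n a b X.
Proof.
move=> fr Th02 [f [cf f0 fa fb ->]]; have /andP[Th0 Th2] := Th02.
have [h1 h2] := frame_orthogonal fr.
exists P, Q, Th, (fun u => f (u * Th)); split=> //; first exact: fr.1.
split.
- move=> u; apply: (@continuous_comp _ _ _ (fun u : RR => u * Th : RR) f); last exact: cf.
  by apply: (@continuousMr RR id (fun=> Th)); [exact: cvg_id|exact: cst_continuous].
- by move=> u /andP[u0 u1]; apply: f0; rewrite mulr_ge0 ?ler_piMl ?(ltW Th0).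
- by rewrite mul0r -fa circ0.
- by rewrite mul1r.
apply/seteqP; split=> [_ [x /= /andP[x0 xT] <-]|_ [u /= /andP[u0 u1] <-]].
  exists (x / Th) => /=; first by rewrite divr_ge0 ?ler_pdivrMr ?mul1r ?(ltW Th0).
  by rewrite divfK// lt0r_neq0.
by exists (u * Th) => //=; rewrite mulr_ge0 ?ler_piMl ?(ltW Th0).
Qed.

Lemma lift_start n a b : dotp n a = 0 -> 0 < tri a b n ->
  exists P Q (r : RR), [/\ frame n P Q, 0 < r & a = r *: circ P Q 0].
Proof.
move=> na h; have [||//|P [Q [r [fr r0 aE]]]] := @frame_exists n a.
- by apply: contraTneq h => ->; rewrite triE !coordE !mul0r ?mulr0 !subr0 !(mul0r, addr0) ltxx.
- by apply: contraTneq h => ->; rewrite triE !coordE !mulr0 !addr0 ltxx.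
by exists P, Q, r; rewrite circ0.
Qed.

Lemma sph_lift1 n a b : dotp n a = 0 -> dotp n b = 0 -> 0 < tri a b n ->
  sph_lift n a b (segment a b).
Proof.
move=> na nb ab; have [P [Q [r [fr r0 aE]]]] := lift_start na ab.
rewrite aE in ab; have [r1 [t1 [r10 /andP[t10 t1pi] bE]]] := angle_step fr r0 nb ab.
rewrite add0r in bE.
apply: (@arc_sph_lift _ P Q t1) => //; first by rewrite t10; lra.
by rewrite aE bE; apply: arc_lift_segment => //; lra.
Qed.

(** Two turns of less than pi each stay below a full circle. *)
Lemma sph_lift2 n a b c : dotp n a = 0 -> dotp n b = 0 -> dotp n c = 0 ->
  0 < tri a b n -> 0 < tri b c n -> sph_lift n a c (segment a b `|` segment b c).
Proof.
move=> na nb nc ab bc; have [P [Q [r [fr r0 aE]]]] := lift_start na ab.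
rewrite aE in ab; have [r1 [t1 [r10 /andP[t10 t1pi] bE]]] := angle_step fr r0 nb ab.
rewrite add0r in bE; rewrite bE in bc.
have [r2 [t2 [r20 /andP[t20 t2pi] cE]]] := angle_step fr r10 nc bc.
apply: (@arc_sph_lift _ P Q (t1 + t2)) => //; first by apply/andP; split; lra.
have := circ_neq0 t1 fr.1 => ct.
rewrite aE bE cE; apply: (arc_lift_cat _ _ ct); first by lra.
- by lra.
- by apply: arc_lift_segment => //; lra.
- by apply: arc_lift_segment => //; lra.
Qed.

(** That [c] points opposite to [a] fixes its angle at pi, so a last turn of less than pi still ends
    before a full circle. *)
Lemma sph_lift3 n a b c d (m : RR) : dotp n a = 0 -> dotp n b = 0 -> dotp n d = 0 ->
  0 < m -> c = - m *: a -> 0 < tri a b n -> 0 < tri c d n ->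
  sph_lift n a d (segment a b `|` segment b c `|` segment c d).
Proof.
move=> na nb nd m0 cE ab cd; have [P [Q [r [fr r0 aE]]]] := lift_start na ab.
rewrite aE in ab; have [r1 [t1 [r10 /andP[t10 t1pi] bE]]] := angle_step fr r0 nb ab.
rewrite add0r in bE.
have mr0 : 0 < m * r by rewrite mulr_gt0.
have {}cE : c = (m * r) *: circ P Q pi.
  by rewrite cE aE circ_pi circ0 scalerA scalerN mulNr scaleNr.
rewrite cE in cd.
have [r2 [t2 [r20 /andP[t20 t2pi] dE]]] := angle_step fr mr0 nd cd.
apply: (@arc_sph_lift _ P Q (pi + t2)) => //; first by apply/andP; split; lra.
have ct := circ_neq0 t1 fr.1; have cp := circ_neq0 pi fr.1.
rewrite aE bE cE dE; apply: (arc_lift_cat _ _ cp); [lra|lra| |].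
  apply: (arc_lift_cat _ _ ct); [lra|lra| |].
  - by apply: arc_lift_segment => //; lra.
  - by apply: arc_lift_segment => //; lra.
by apply: arc_lift_segment => //; lra.
Qed.

(** The diagram conditions come from the normals alone. Two lifts may meet only at the end of one of
    their arcs, and half-open parameters leave the ends out, so the lifted curve is injective. *)
Lemma sps_of_lifts m (n s e : nat -> pt) (X : nat -> set pt) (S : set pt) :
  (1 < m)%N ->
  (forall i, (i < m)%N -> sph_lift (n i) (s i) (e i) (X i)) ->
  (forall i, (i < m)%N -> e i = s (cyc_next m i)) ->
  (forall i j x, (i < m)%N -> (j < m)%N -> i <> j -> X i x -> X j x -> x = e i \/ x = e j) ->
  (forall i j k, (i < m)%N -> (j < m)%N -> (k < m)%N -> i <> j -> j <> k -> i <> k ->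
     tri (n i) (n j) (n k) != 0) ->
  (forall i j, (i < m)%N -> (j < m)%N -> i <> j -> crossp (n i) (n j) != 0) ->
  knot_equiv [set x | exists2 i, (i < m)%N & X i x] S ->
  sps_rep S m.
Proof.
move=> m1 lift es disj gen3 gen2 eqv.
have m0 : (0 < m)%N by lia.
have /choice[D hD] : forall i, exists D : pt * pt * RR * (RR -> RR),
    (i < m)%N -> sph_lift_by (n i) (s i) (e i) (X i) D.1.1.1 D.1.1.2 D.1.2 D.2.
  move=> i; have [/lift[P [Q [Th [rho h]]]]|hi] := boolP (i < m)%N.
    by exists (P, Q, Th, rho).
  (* A default for indices out of range, where nothing is required. *)
  by exists (0, 0, 0, fun=> 0).
pose P i := (D i).1.1.1; pose Q i := (D i).1.1.2; pose Th i := (D i).1.2; pose rho i := (D i).2.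
have lift4 i : (i < m)%N -> sph_lift_by (n i) (s i) (e i) (X i) (P i) (Q i) (Th i) (rho i).
  exact: hD.
move: P Q Th rho lift4 => P Q Th rho lift4; clear D hD lift.
have unitP i : (i < m)%N -> dotp (P i) (P i) = 1 by move=> /lift4[[]].
have ray (a b : RR) (u v : pt) : 0 < a -> 0 < b -> dotp u u = 1 -> dotp v v = 1 ->
    a *: u = b *: v -> u = v.
  move=> a0 b0 uu vv E.
  have : a ^+ 2 = b ^+ 2.
    by have := congr1 (fun x => dotp x x) E; rewrite /= !dotp_lin uu vv !mulr1 -!expr2.
  move=> /eqP; rewrite eqrXn2 ?(ltW a0) ?(ltW b0)// => /eqP ab.
  by move: E; rewrite ab; apply: scalerI; rewrite lt0r_neq0.
have h0 : 0 <= (0 : RR) <= 1 by rewrite lexx ler01.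
have h1 : 0 <= (1 : RR) <= 1 by rewrite lexx ler01.
exists P, Q, Th, rho; split.
  apply: (@sph_curve_of_normals _ _ _ _ n) => //.
    by move=> i /lift4[].
  move=> i hi; have hj := cyc_next_lt i m0.
  have [oi _ _ _ [_ r0 _ eE _]] := lift4 i hi; have [oj _ _ _ [_ r0' sE _ _]] := lift4 _ hj.
  apply: (ray (rho i 1) (rho (cyc_next m i) 0)); rewrite ?r0 ?r0' ?circ_unit ?unitP//.
  by rewrite eE sE es.
have lE i u : rho i u *: sph_pieces P Q Th i u = rho i u *: circ (P i) (Q i) (u * Th i) by [].
split; first by move=> i /lift4[_ _ _ _ [c _ _ _ _]]; exact: continuous_subspaceT.
split; first by move=> i u /lift4[_ _ _ _ [_ r0 _ _ _]]; exact: r0.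
split; last first.
  rewrite (_ : curve_set _ _ = [set x | exists2 i, (i < m)%N & X i x])//.
  apply/seteqP; split=> [x [i [u [hi [hu <-]]]]|x [i hi]].
    by exists i => //; have [_ _ _ _ [_ _ _ _ ->]] := lift4 i hi; exists u.
  by have [_ _ _ _ [_ _ _ _ ->]] := lift4 i hi; move=> [u hu <-]; exists i, u.
have inj i u w : (i < m)%N -> 0 <= u <= 1 -> 0 <= w <= 1 ->
    rho i u *: sph_pieces P Q Th i u = rho i w *: sph_pieces P Q Th i w -> u = w.
  move=> hi hu hw; have [oi /andP[T0 T2] _ _ [_ r0 _ _ _]] := lift4 i hi.
  rewrite !lE => /ray; rewrite !r0// !circ_unit// => /(_ erefl erefl erefl erefl) /(circ_inj oi) E.
  apply: (mulIf (lt0r_neq0 T0)); apply: E; rewrite -mulrBl normrM (gtr0_norm T0).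
  by apply: le_lt_trans T2; apply: ler_piMl; [exact: ltW|rewrite ler_norml; lra].
split=> //; split.
  move=> i hi; apply: continuous_subspaceT => u.
  apply: (@continuousZv RR); first by have [_ _ _ _ [c _ _ _ _]] := lift4 i hi; exact: c.
  have cm : {for (u : RR), continuous (fun u : RR => u * Th i : RR)}.
    by apply: (@continuousMr RR id (fun=> Th i)); [exact: cvg_id|exact: cst_continuous].
  apply: (@continuousDv RR).
    apply: (@continuousZv RR _ (fun=> P i)); last exact: cst_continuous.
    exact: (@continuous_cosr RR).
  apply: (@continuousZv RR _ (fun=> Q i)); last exact: cst_continuous.
  exact: (@continuous_sinr RR).
split.
  move=> i hi; have hj := cyc_next_lt i m0.
  have [_ _ _ _ [_ _ _ eE _]] := lift4 i hi; have [_ _ _ _ [_ _ sE _ _]] := lift4 _ hj.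
  by rewrite !lE mul1r mul0r circ0 eE sE es.
move=> i j u w hi hj hu hw E.
have [ij|/eqP ij] := eqVneq i j.
  by split=> //; rewrite -ij in E *; apply: (inj i) => //; lra.
have [_ _ _ _ [_ _ _ eiE XiE]] := lift4 i hi.
have [_ _ _ _ [_ _ _ ejE XjE]] := lift4 j hj.
have Xi : X i (rho i u *: sph_pieces P Q Th i u).
  by rewrite XiE; exists u => //=; lra.
have Xj : X j (rho i u *: sph_pieces P Q Th i u).
  by rewrite XjE E; exists w => //=; lra.
exfalso; have [h|h] := disj i j _ hi hj ij Xi Xj.
  have : u = 1 by apply: (inj i) => //; [lra|rewrite h lE mul1r eiE].
  lra.
have : w = 1 by apply: (inj j) => //; [lra|rewrite -E h lE mul1r ejE].
lra.
Qed.

(** * The spherical diagram seen from a vertex *)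

Lemma crossp_neq0_of_tri a b c : tri a b c != 0 -> crossp a b != 0.
Proof. by apply: contraNneq => E; rewrite /tri E dotpE !coordE !mul0r !addr0. Qed.

Lemma tri_self_gt0 a b : crossp a b != 0 -> 0 < tri a b (crossp a b).
Proof. by rewrite /tri dotp_gt0. Qed.

Section generic.
Variables (N : nat) (w : nat -> pt).
Hypothesis gen : generic_dirs N w.
Local Notation n i := (crossp (w i) (w i.+1)).

Lemma generic_normal_neq0 i : (2 < N)%N -> (i.+1 < N)%N -> n i != 0.
Proof.
move=> N2 hi; case: i hi => [|i] hi.
  by apply: (@crossp_neq0_of_tri _ _ (w 2)); apply: gen.1; lia.
by apply: (@crossp_neq0_of_tri _ _ (w 0)); rewrite tri_rot; apply: gen.1; lia.
Qed.

Lemma generic_normals_independent i j k : (i.+1 < N)%N -> (j.+1 < N)%N -> (k.+1 < N)%N ->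
  i <> j -> j <> k -> i <> k -> tri (n i) (n j) (n k) != 0.
Proof.
move=> hi hj hk ij jk ik; have g := gen.2.
have [h|h] := ltnP i j; have [h'|h'] := ltnP j k; have [h''|h''] := ltnP i k; try lia.
- by apply: g; lia.
- by rewrite tri_rot tri_swap oppr_eq0; apply: g; lia.
- by rewrite tri_rot; apply: g; lia.
- by rewrite tri_swap oppr_eq0; apply: g; lia.
- by rewrite -tri_rot; apply: g; lia.
- by rewrite tri_swap oppr_eq0 tri_rot; apply: g; lia.
Qed.

(** For i < j, (n_i x n_j) x w_(j+1) = (n_i . w_(j+1)) n_j, because w_(j+1) is orthogonal to n_j,
    and the scalar is a nonzero determinant of directions. The condition on triples does not give
    this when N = 3, where there are only two planes. *)
Lemma generic_normals_nonparallel i j : (2 < N)%N -> (i.+1 < N)%N -> (j.+1 < N)%N ->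
  i <> j -> crossp (n i) (n j) != 0.
Proof.
move=> N2; wlog ij : i j / (i < j)%N => [hw hi hj ne|hi hj _].
  have [h|h] := ltnP i j; first exact: hw.
  have -> : crossp (n i) (n j) = - crossp (n j) (n i) by apply: pt_ext; pring.
  by rewrite oppr_eq0; apply: hw => //; lia.
apply/eqP => E.
have t0 : dotp (n i) (w j.+1) != 0 by apply: gen.1; lia.
have := crossp_crossp (n i) (n j) (w j.+1).
rewrite E dotp_crossp_r scale0r subr0.
have -> : crossp 0 (w j.+1) = 0 by apply: pt_ext; pring.
move=> /esym/eqP; rewrite scaler_eq0 (negbTE t0) /=; apply/negP.
exact: generic_normal_neq0.
Qed.
End generic.

Lemma segmentP M V a x : segment (V a) (V (cyc_next M a)) x <->
  exists2 u : RR, 0 <= u <= 1 & poly_pieces M V a u = x.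
Proof. by split=> -[u hu <-]; exists u. Qed.

(** All edges from [V N.-2] up to [V M.-1] lie over the last arc and the closing edge lies over the
    first one, so vertices after [V N.-1] add no arc. *)
Lemma sps_of_polygon N M (V : nat -> pt) (S : set pt) :
  (2 < N)%N -> (N < M)%N -> poly_emb M V -> generic_dirs N V ->
  sph_lift (crossp (V 0%N) (V 1%N)) (V M.-1) (V 1%N)
    (segment (V M.-1) (V 0%N) `|` segment (V 0%N) (V 1%N)) ->
  sph_lift (crossp (V N.-2) (V N.-1)) (V N.-2) (V M.-1)
    [set x | exists2 a, (N.-2 <= a < M.-1)%N & segment (V a) (V a.+1) x] ->
  knot_equiv (poly_set M V) S ->
  sps_rep S N.-1.
Proof.
move=> N2 NM emb gen lift0 liftN eqv.
(* The edge a of the polygon is part of the lift of the arc grp a. *)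
pose grp a := if a == M.-1 then 0%N else minn a N.-2.
pose X i := [set x | exists2 a, (a < M)%N /\ grp a = i & segment (V a) (V (cyc_next M a)) x].
pose e i := if i == N.-2 then V M.-1 else V i.+1.
pose s i := if i == 0%N then V M.-1 else V i.
have nextE a : (a < M.-1)%N -> cyc_next M a = a.+1.
  by move=> ha; rewrite cyc_nextE ?ifN//; lia.
have next_last : cyc_next M M.-1 = 0%N by rewrite cyc_nextE ?ifT//; lia.
apply: (@sps_of_lifts _ (fun i => crossp (V i) (V i.+1)) s e X); first by lia.
- move=> i hi; have [i0|i0] := posnP i.
    rewrite i0 /s /e /= ifN; last by lia.
    rewrite (_ : X 0%N = segment (V M.-1) (V 0%N) `|` segment (V 0%N) (V 1%N))//.
    apply/seteqP; split=> [x [a [ha ga] ax]|x [ax|ax]].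
    + move: ga; rewrite /grp; case: eqP => [aM _|aM ga].
        by left; move: ax; rewrite aM next_last.
      have a0 : a = 0%N by lia.
      by right; move: ax; rewrite a0 nextE//; lia.
    + by exists M.-1; rewrite ?next_last// /grp eqxx; split=> //; lia.
    + by exists 0%N; rewrite ?nextE// ?/grp ?ifN; try lia; split; lia.
  have [iN|iN] := eqVneq i N.-2.
    rewrite iN /s /e eqxx ifN; last by lia.
    have -> : N.-2.+1 = N.-1 by lia.
    rewrite (_ : X N.-2 = [set x | exists2 a, (N.-2 <= a < M.-1)%N & segment (V a) (V a.+1) x])//.
    apply/seteqP; split=> [x [a [ha ga] ax]|x [a ha ax]].
    + move: ga; rewrite /grp; case: eqP => [aM|aM ga]; first by lia.
      by exists a; [lia|move: ax; rewrite nextE//; lia].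
    + by exists a; [rewrite /grp ifN; lia|rewrite nextE//; lia].
  rewrite /s /e (negbTE iN) ifN; last by lia.
  rewrite (_ : X i = segment (V i) (V i.+1)).
    apply: sph_lift1; rewrite ?dotp_crossp_l ?dotp_crossp_r//.
    by apply/tri_self_gt0/(generic_normal_neq0 gen); lia.
  apply/seteqP; split=> [x [a [ha ga] ax]|x ax].
    move: ga; rewrite /grp; case: eqP => [aM|aM ga]; first by lia.
    have ai : a = i by lia.
    by move: ax; rewrite ai nextE//; lia.
  by exists i; [rewrite /grp ifN; lia|rewrite nextE//; lia].
- move=> i hi; rewrite /e /s cyc_nextE//.
  have [->|iN] := eqVneq i N.-2.
    have -> : (N.-2.+1 == N.-1) = true by lia.
    by rewrite eqxx.
  by have -> : (i.+1 == N.-1) = false by lia.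
(* Lifts of different arcs share only vertices between consecutive edges, and such a vertex is the
   end of the arc of the earlier edge. *)
- have next_case a b : (a < M)%N -> (b < M)%N -> grp a <> grp b -> b = cyc_next M a ->
      V b = e (grp a).
    move=> ha hb; rewrite /e /grp; have [->|aM] := eqVneq a M.-1.
      by rewrite next_last => ne b0; exfalso; move: ne; rewrite b0; case: eqP; lia.
    rewrite nextE; last by lia.
    move=> + bE; rewrite bE; case: (eqVneq a.+1 M.-1) => [h1 _|h1 h2].
      by rewrite h1 ifT//; lia.
    by rewrite ifN; [congr V; lia|lia].
  move=> i j x hi hj ij [a [ha gi] /segmentP[u hu <-]] [b [hb gj] /segmentP[t ht E]].
  rewrite -gi -gj in ij *.
  have [[ab _]|[bE _ t0]|[aE _ u0]] := poly_emb_closed emb ha hb hu ht (esym E).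
  + by rewrite ab in ij.
  + by left; rewrite -(next_case a b)// -E t0 poly_pieces0.
  + by right; rewrite -(next_case b a)// ?u0 ?poly_pieces0//; exact: nesym.
- by move=> i j k hi hj hk ij jk ik; apply: (generic_normals_independent gen) => //; lia.
- by move=> i j hi hj ij; apply: (generic_normals_nonparallel gen) => //; lia.
rewrite (_ : [set x | _] = poly_set M V)//.
apply/seteqP; split=> [x [i hi [a [ha _] /segmentP[u hu <-]]]|x [a [u [ha [hu <-]]]]].
  by exists a, u.
exists (grp a); first by rewrite /grp; case: eqP; lia.
by exists a => //; apply/segmentP; exists u.
Qed.

(* [lia] slows down dramatically when vectors indexed by [N.-1] or [N.-2] are
   around, hence the clearing. *)
Ltac is_nat_fact P := lazymatch P with
  | nat => idtac
  | @eq nat _ _ => idtac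
  | is_true (leq _ _) => idtac
  | is_true (andb (leq _ _) (leq _ _)) => idtac
  | is_true (negb (@eq_op _ ?a _)) => let _ := constr:(a : nat) in idtac
  end.
Ltac nlia := repeat match goal with H : ?P |- _ => tryif is_nat_fact P then fail else clear H end; lia.

(** * Closing the diagram on the common line of two planes *)

Lemma small_scale (a : pt) (e : RR) : 0 < e -> exists2 c : RR, 0 < c & `|c *: a| < e.
Proof.
move=> e0; have a1 : 0 < `|a| + 1 by rewrite ltr_wpDl.
exists (e / (`|a| + 1)); first exact: divr_gt0.
rewrite normrZ gtr0_norm ?divr_gt0// mulrAC ltr_pdivrMr//.
by rewrite ltr_pM2l// ltrDl.
Qed.

Lemma poly_add_le N w b i : (i < N)%N -> poly_add N w b i = w i.
Proof. by rewrite /poly_add => ->. Qed.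

Lemma poly_add_last N w b : poly_add N w b N = b.
Proof. by rewrite /poly_add ltnn. Qed.

Lemma generic_dirs_ext N w w' : (forall i, (i < N)%N -> w i = w' i) ->
  generic_dirs N w -> generic_dirs N w'.
Proof.
move=> E [g1 g2]; split=> i j k ijk hk; first by rewrite -!E//; [exact: g1|nlia|nlia].
by rewrite -!E; [exact: g2|nlia..].
Qed.

Lemma generic_dirs_rev N w : generic_dirs N w -> generic_dirs N (fun i => w (N.-1 - i)%N).
Proof.
move=> [g1 g2]; split=> i j k ijk hk.
  by rewrite tri_swap oppr_eq0 -tri_rot tri_rot tri_rot; apply: g1; nlia.
have E l : (l.+1 < N)%N -> crossp (w (N.-1 - l)%N) (w (N.-1 - l.+1)%N) =
    - crossp (w (N.-2 - l)%N) (w (N.-2 - l).+1).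
  move=> hl; have -> : (N.-1 - l.+1 = N.-2 - l)%N by nlia.
  have -> : (N.-1 - l = (N.-2 - l).+1)%N by nlia.
  by apply: pt_ext; pring.
rewrite !E; try nlia.
set x := crossp (w (N.-2 - i)%N) _; set y := crossp (w (N.-2 - j)%N) _.
set z := crossp (w (N.-2 - k)%N) _.
have -> : tri (- x) (- y) (- z) = tri z y x by pring.
by apply: g2; nlia.
Qed.

(* The case where both extended arcs reach the direction d before -d. *)
Lemma sps_short N w d (x1 y1 x2 y2 : RR) (S : set pt) :
  (2 < N)%N -> poly_emb N.+1 (poly_add N w 0) -> generic_dirs N w ->
  d = x1 *: w 0%N + y1 *: w 1%N -> d = x2 *: w N.-1 + y2 *: w N.-2 ->
  y1 < 0 -> y2 < 0 ->
  knot_equiv (poly_set N.+1 (poly_add N w 0)) S -> sps_rep S N.-1.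
Proof.
move=> N2 emb gen d1 d2 y10 y20 eqv.
have [e e0 he] := poly_stable emb.
(* So small a multiple of [d] stays within the stability radius around the vertex 0. *)
have [c c0 ce] := small_scale d e0.
pose V := poly_add N w (c *: d).
have [|emb' eqv'] := he V.
  move=> i _; rewrite /V /poly_add; case: ifP => _; first by rewrite subrr normr0.
  by rewrite subr0.
have Vw i : (i < N)%N -> V i = w i by exact: poly_add_le.
have VN : V N = c *: d by exact: poly_add_last.
have n0 : crossp (w 0%N) (w 1%N) != 0 by apply: (generic_normal_neq0 gen); nlia.
have nN : crossp (w N.-2) (w N.-1) != 0.
  have -> : w N.-1 = w N.-2.+1 by congr w; nlia.
  by apply: (generic_normal_neq0 gen); nlia.
apply: (@sps_of_polygon N N.+1 V) => //.
- by apply: generic_dirs_ext gen => i hi; rewrite Vw.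
- rewrite /= VN !Vw; try nlia.
  have d0 : dotp (crossp (w 0%N) (w 1%N)) (c *: d) = 0.
    by rewrite dotpZr d1 !dotp_lin dotp_crossp_l dotp_crossp_r !mulr0 addr0 mulr0.
  apply: sph_lift2; rewrite ?dotp_crossp_l ?dotp_crossp_r//; last exact: tri_self_gt0.
  (* The negative coefficient of [w 1] in [d] makes the turn from [d] to [w 0] positive. *)
  have -> : tri (c *: d) (w 0%N) (crossp (w 0%N) (w 1%N)) =
      (c * - y1) * tri (w 0%N) (w 1%N) (crossp (w 0%N) (w 1%N)) by rewrite d1; pring.
  by rewrite pmulr_rgt0 ?tri_self_gt0// mulr_gt0// oppr_gt0.
- rewrite /= VN !Vw; try nlia.
  have d0 : dotp (crossp (w N.-2) (w N.-1)) (c *: d) = 0.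
    by rewrite dotpZr d2 !dotp_lin dotp_crossp_l dotp_crossp_r !mulr0 addr0 mulr0.
  have s1 : V N.-2.+1 = w N.-1 by rewrite Vw; [congr w; nlia|nlia].
  have s2 : V N.-1.+1 = c *: d by rewrite -VN; congr V; nlia.
  have -> : [set x | exists2 a, (N.-2 <= a < N)%N & segment (V a) (V a.+1) x] =
      segment (w N.-2) (w N.-1) `|` segment (w N.-1) (c *: d).
    apply/seteqP; split=> [x [a ha]|x [ax|ax]].
    + have [->|->] : a = N.-2 \/ a = N.-1 by nlia.
      * by rewrite s1 Vw; [left|nlia].
      * by rewrite s2 Vw; [right|nlia].
    + by exists N.-2; [nlia|rewrite s1 Vw//; nlia].
    + by exists N.-1; [nlia|rewrite s2 Vw//; nlia].
  apply: sph_lift2; rewrite ?dotp_crossp_l ?dotp_crossp_r//; first exact: tri_self_gt0.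
  have -> : tri (w N.-1) (c *: d) (crossp (w N.-2) (w N.-1)) =
      (c * - y2) * tri (w N.-2) (w N.-1) (crossp (w N.-2) (w N.-1)) by rewrite d2; pring.
  by rewrite pmulr_rgt0 ?tri_self_gt0// mulr_gt0// oppr_gt0.
- exact: knot_equiv_trans (knot_equiv_sym eqv') eqv.
Qed.

(** Supplies the room for the insertion in [sps_long]: the triangle swept there stays closer than
    this to the edge from 0 to [w 0]. *)
Lemma far_edges_sep N w : (2 < N)%N -> poly_emb N.+1 (poly_add N w 0) ->
  exists2 k : RR, 0 < k & forall j u z, (0 < j)%N -> (j.+1 < N)%N ->
    0 <= u <= 1 -> 0 <= z <= 1 ->
    k <= `|(1 - u) *: w j + u *: w j.+1 - z *: w 0%N|.
Proof.
move=> N2 emb; have [K K0 hK] := poly_bilipschitz emb.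
have K1 : 0 < K + 1 by lra.
(* The displacement D moves the far edges rigidly and leaves the edge from 0 to
   w 0 fixed, so the Lipschitz bound forces them apart. *)
pose b : pt := const_mx 1.
pose D i : pt := if (0 < i < N)%N then b else 0.
have nb : `|b| = 1.
  apply/eqP; rewrite eq_le; apply/andP; split.
    by apply: norm_le_coord => // k; rewrite mxE normr1.
  by have := coord_le_norm b ord0; rewrite mxE normr1.
have nD i : (i < N.+1)%N -> `|D i| <= 1.
  by move=> _; rewrite /D; case: ifP => _; rewrite ?nb ?normr0.
exists (K + 1)^-1; first by rewrite invr_gt0.
move=> j u z j0 jN hu hz.
have := hK D 1 nD j N u z; rewrite ltnSn => /(_ _ _ hu hz).
have -> : (j < N.+1)%N by nlia.
move=> /(_ isT isT).
have -> : poly_pieces N.+1 D j u = b.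
  rewrite /poly_pieces /D cyc_nextE; last by nlia.
  have -> : (j.+1 == N.+1) = false by nlia.
  have -> : (0 < j < N)%N by nlia.
  by rewrite jN /= -scalerDl subrK scale1r.
have -> : poly_pieces N.+1 D N z = 0.
  rewrite /poly_pieces /D cyc_nextE// eqxx ltnn andbF /=.
  by rewrite !scaler0 addr0.
rewrite subr0 nb mulr1.
have -> : poly_pieces N.+1 (poly_add N w 0) j u = (1 - u) *: w j + u *: w j.+1.
  by rewrite poly_add_pieces// /poly_pieces cyc_nextE ?ifN//; nlia.
have -> : poly_pieces N.+1 (poly_add N w 0) N z = z *: w 0%N.
  rewrite /poly_pieces cyc_nextE// eqxx poly_add_last poly_add_le; last by nlia.
  by rewrite scaler0 add0r.
move=> h; rewrite -(ler_pM2l K1) mulfV ?lt0r_neq0//.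
apply: (le_trans h); apply: ler_wpM2r => //; lra.
Qed.

(* The case where the last arc has to go past -d before it reaches d: the lift
   is made to turn around 0 on the far side, through a small multiple of
   - w_(N-2). *)
Lemma sps_long N w d (x1 y1 x2 y2 : RR) (S : set pt) :
  (2 < N)%N -> poly_emb N.+1 (poly_add N w 0) -> generic_dirs N w ->
  d = x1 *: w 0%N + y1 *: w 1%N -> d = x2 *: w N.-1 + y2 *: w N.-2 ->
  y1 < 0 -> x2 < 0 ->
  knot_equiv (poly_set N.+1 (poly_add N w 0)) S -> sps_rep S N.-1.
Proof.
move=> N2 emb gen d1 d2 y10 x20 eqv.
(* With three directions, [w N.-2] is [w 1], and independence would force [x2 = 0]. *)
have N3 : (3 < N)%N.
  rewrite ltn_neqAle N2 andbT; apply/eqP => N3.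
  have t0 : tri (w 0%N) (w 1%N) (w 2%N) != 0 by apply: gen.1; nlia.
  have [|_ _ h] := @tri_free _ _ _ x1 (y1 - y2) (- x2) t0.
    transitivity (d - d); last by rewrite subrr.
    by rewrite {1}d1 d2 -N3 /=; apply: pt_ext; pring.
  by clear -h x20; lra.
have [e e0 he] := poly_stable emb.
have [k k0 hk] := far_edges_sep N2 emb.
(* The bound [e] serves stability; the two bounds [k / 2], on [p] and on [c *: d], add up to keep
   the swept triangle off the far edges. *)
have [|m m0 me] := @small_scale (w N.-2) (Num.min e (k / 2)).
  by rewrite lt_min e0 divr_gt0.
move: me; rewrite lt_min => /andP[me mk].
have [|c c0 ck] := @small_scale d (k / 2); first by rewrite divr_gt0.
pose p := - m *: w N.-2.
have pE : p = - (m *: w N.-2) by rewrite /p scaleNr.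
pose W := poly_add N w p.
have [|emb' eqv'] := he W.
  move=> i _; rewrite /W /poly_add; case: ifP => _; first by rewrite subrr normr0.
  by rewrite subr0 pE normrN.
have Ww i : (i < N)%N -> W i = w i by exact: poly_add_le.
have WN : W N = p by exact: poly_add_last.
have g i j l : (i < j < l)%N -> (l < N)%N -> tri (w i) (w j) (w l) != 0 by exact: gen.1.
have tAB : tri (w 0%N) (w N.-2) (w N.-1) != 0 by apply: g; nlia.
have t01 : tri (w 0%N) (w 1%N) (w N.-2) != 0 by apply: g; nlia.
have cx2 : c * x2 < 0 by rewrite pmulr_rlt0.
have cy1 : c * y1 < 0 by rewrite pmulr_rlt0.
(* The vertex [c *: d] goes between [p] and [w 0]; the triangle of these three points has to be
   empty. *)
have [||emb2 eqv2] := @poly_insert N W (c *: d) emb'.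
- move=> x y z; rewrite WN Ww; last by nlia.
  rewrite d2 pE => E _.
  have [|hz hx hy] := @tri_free _ _ _ z (- x * m + y * (c * y2)) (y * (c * x2)) tAB.
    by rewrite -[RHS]E; apply: pt_ext; pring.
  have y0 : y = 0.
    by move/eqP: hy; rewrite mulf_eq0 (lt_eqF cx2) orbF => /eqP.
  split=> //; move/eqP: hx; rewrite y0 mul0r addr0 mulf_eq0 (gt_eqF m0) orbF oppr_eq0.
  by move=> /eqP.
- move=> j u x y z hj hu x0 y0 z0 xyz; rewrite WN Ww; last by nlia.
  have [u0 u1] := andP hu.
  (* On the first edge the coefficient of [w 1] is [u >= 0], on the triangle it is
     [y * (c * y1) <= 0]: only the corner [w 0] is shared. *)
  have [->|j0] := posnP j.
    rewrite /poly_pieces cyc_nextE// ifN; last by nlia.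
    rewrite !Ww; try nlia.
    move=> E; split=> //.
    have [|h1 h2 h3] := @tri_free _ _ _ (1 - u - y * (c * x1) - z) (u - y * (c * y1)) (x * m) t01.
      move/eqP: E; rewrite -subr_eq0 d1 pE => /eqP E; rewrite -[RHS]E.
      by apply: pt_ext; pring.
    by have := mulr_ge0_le0 y0 (ltW cy1); clear -h2 u0; lra.
  (* On this edge the coefficient of [w N.-1] is [1 - u > 0], on the triangle it is
     [y * (c * x2) <= 0]. *)
  have [jN|jN] := eqVneq j N.-1.
    rewrite jN /poly_pieces cyc_nextE ?ifN; try nlia.
    have -> : N.-1.+1 = N by nlia.
    rewrite WN Ww; last by nlia.
    move=> E; exfalso.
    have [|h1 h2 h3] := @tri_free _ _ _ z (y * (c * y2) - x * m + u * m) (y * (c * x2) - (1 - u)) tAB.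
      move/esym/eqP: E; rewrite -subr_eq0 d2 pE => /eqP E; rewrite -[RHS]E.
      by apply: pt_ext; pring.
    by have := mulr_ge0_le0 y0 (ltW cx2); clear -h3 u1; lra.
  have j1 : (j.+1 < N)%N by nlia.
  rewrite /poly_pieces cyc_nextE; last by nlia.
  have -> : (j.+1 == N.+1) = false by nlia.
  rewrite (Ww j)// (Ww j.+1)// => E; exfalso.
  have u01 : 0 <= u <= 1 by rewrite u0 ltW.
  have z01 : 0 <= z <= 1 by clear -x0 y0 z0 xyz; lra.
  have := hk j u z j0 j1 u01 z01.
  rewrite E.
  have -> : x *: p + y *: (c *: d) + z *: w 0%N - z *: w 0%N = x *: p + y *: (c *: d) by rewrite addrK.
  apply/negP; rewrite -ltNge; apply: (le_lt_trans (ler_normD _ _)).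
  rewrite !(normrZ x) !(normrZ y) (ger0_norm x0) (ger0_norm y0) pE normrN.
  have x1' : x <= 1 by clear -x0 y0 z0 xyz; lra.
  have y1' : y <= 1 by clear -x0 y0 z0 xyz; lra.
  have := ler_wpM2r (normr_ge0 (m *: w N.-2)) x1'.
  have := ler_wpM2r (normr_ge0 (c *: d)) y1'.
  by rewrite !mul1r; clear -mk ck; lra.
pose V := poly_add N.+1 W (c *: d).
have Vw i : (i < N)%N -> V i = w i.
  by move=> hi; rewrite /V poly_add_le ?Ww//; nlia.
have VN : V N = p by rewrite /V poly_add_le.
have VN1 : V N.+1 = c *: d by exact: poly_add_last.
have n0 : crossp (w 0%N) (w 1%N) != 0 by apply: (generic_normal_neq0 gen); nlia.
have nN : crossp (w N.-2) (w N.-1) != 0.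
  have -> : w N.-1 = w N.-2.+1 by congr w; nlia.
  by apply: (generic_normal_neq0 gen); nlia.
apply: (@sps_of_polygon N N.+2 V) => //.
- by apply: generic_dirs_ext gen => i hi; rewrite Vw.
- rewrite /= VN1 !Vw; try nlia.
  have d0 : dotp (crossp (w 0%N) (w 1%N)) (c *: d) = 0.
    by rewrite dotpZr d1 !dotp_lin dotp_crossp_l dotp_crossp_r !mulr0 addr0 mulr0.
  apply: sph_lift2; rewrite ?dotp_crossp_l ?dotp_crossp_r//; last exact: tri_self_gt0.
  have -> : tri (c *: d) (w 0%N) (crossp (w 0%N) (w 1%N)) =
      (- (c * y1)) * tri (w 0%N) (w 1%N) (crossp (w 0%N) (w 1%N)) by rewrite d1; pring.
  by rewrite pmulr_rgt0 ?tri_self_gt0// oppr_gt0.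
- rewrite /= VN1 !Vw; try nlia.
  have d0 : dotp (crossp (w N.-2) (w N.-1)) (c *: d) = 0.
    by rewrite dotpZr d2 !dotp_lin dotp_crossp_l dotp_crossp_r !mulr0 addr0 mulr0.
  have s1 : V N.-2.+1 = w N.-1 by rewrite Vw; [congr w; nlia|nlia].
  have s2 : V N.-1.+1 = p by rewrite -VN; congr V; nlia.
  have -> : [set x | exists2 a, (N.-2 <= a < N.+1)%N & segment (V a) (V a.+1) x] =
      segment (w N.-2) (w N.-1) `|` segment (w N.-1) p `|` segment p (c *: d).
    apply/seteqP; split=> [x [a ha]|x [[ax|ax]|ax]].
    + have [->|[->|->]] : a = N.-2 \/ a = N.-1 \/ a = N by nlia.
      * by rewrite s1 Vw; [left; left|nlia].
      * by rewrite s2 Vw; [left; right|nlia].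
      * by rewrite VN VN1; right.
    + by exists N.-2; [nlia|rewrite s1 Vw//; nlia].
    + by exists N.-1; [nlia|rewrite s2 Vw//; nlia].
    + by exists N; [nlia|rewrite VN VN1].
  apply: (@sph_lift3 _ _ _ _ _ m); rewrite ?dotp_crossp_l ?dotp_crossp_r//; first exact: tri_self_gt0.
  have -> : tri p (c *: d) (crossp (w N.-2) (w N.-1)) =
      (- (c * x2) * m) * tri (w N.-2) (w N.-1) (crossp (w N.-2) (w N.-1)) by rewrite d2 /p; pring.
  by rewrite pmulr_rgt0 ?tri_self_gt0// mulr_gt0// oppr_gt0.
- exact: knot_equiv_trans (knot_equiv_sym eqv2) (knot_equiv_trans (knot_equiv_sym eqv') eqv).
Qed.

Lemma sps_of_generic N w h (S : set pt) :
  (2 < N)%N -> poly_emb N.+1 (poly_add N w 0) -> generic_dirs N w ->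
  (forall i, (i < N)%N -> 0 < dotp h (w i)) ->
  knot_equiv (poly_set N.+1 (poly_add N w 0)) S -> sps_rep S N.-1.
Proof.
move=> N2 emb gen hpos eqv.
pose A := w N.-2; pose B := w N.-1.
have t1 : tri (w 0%N) A B != 0 by apply: gen.1; nlia.
have t2 : tri (w 0%N) (w 1%N) B != 0 by apply: gen.1; nlia.
have t1s : 0 < tri (w 0%N) A B ^+ 2 by rewrite exprn_even_gt0.
(* The linear relation between [w 0], [w 1], [A], [B], whose coefficients are signed determinants of
   three of them, multiplied by [tri (w 0) A B] so that [y1] is minus a square. *)
pose y1 := - tri (w 0%N) A B ^+ 2; pose x1 := tri (w 0%N) A B * tri (w 1%N) A B.
pose y2 := - (tri (w 0%N) A B * tri (w 0%N) (w 1%N) B).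
pose x2 := tri (w 0%N) A B * tri (w 0%N) (w 1%N) A.
pose d := x1 *: w 0%N + y1 *: w 1%N.
have d2 : d = x2 *: B + y2 *: A by rewrite /d /x1 /y1 /x2 /y2; apply: pt_ext; pring.
have y10 : y1 < 0 by rewrite oppr_lt0.
have y2n : y2 != 0 by rewrite oppr_eq0 mulf_neq0.
have [y20|y20] := ltrP y2 0; first exact: (@sps_short N w d x1 y1 x2 y2).
have {}y20 : 0 < y2 by rewrite lt_neqAle eq_sym y2n.
have [x20|x20] := ltrP x2 0; first exact: (@sps_long N w d x1 y1 x2 y2).
(* Here [d] lies in the cone of [A] and [B], so [h] is positive on it; as [y1 < 0], the positive
   part must come from [w 0]. *)
have x10 : 0 < x1.
  have : dotp h d = x2 * dotp h B + y2 * dotp h A by rewrite d2 !dotp_lin.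
  rewrite /d !dotp_lin.
  have h0 : 0 < dotp h (w 0%N) by apply: hpos; nlia.
  have h1 : 0 < dotp h (w 1%N) by apply: hpos; nlia.
  have hA : 0 < dotp h A by apply: hpos; nlia.
  have hB : 0 < dotp h B by apply: hpos; nlia.
  have := mulr_gt0 y20 hA; have := mulr_ge0 x20 (ltW hB).
  have : y1 * dotp h (w 1%N) < 0 by rewrite pmulr_llt0.
  rewrite -(pmulr_lgt0 x1 h0); lra.
have [emb' set'] := poly_rev emb.
set v' := fun i => _ in emb' set'.
have E i : (i < N.+1)%N -> v' i = poly_add N (fun i => w (N.-1 - i)%N) 0 i.
  rewrite /v' /poly_add ltnn; case: ifP => // hi _.
  by rewrite ifT//; nlia.
(* Reversal exchanges the two arcs. For [- d] the new [y1] is [- y2] and the new [x2] is [- x1],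
   both negative. *)
apply: (@sps_long N (fun i => w (N.-1 - i)%N) (- d) (- x2) (- y2) (- x1) (- y1)) => //.
- exact: poly_emb_ext E emb'.
- exact: generic_dirs_rev.
- by rewrite d2 subn0 subn1 !scaleNr opprD.
- have -> : (N.-1 - N.-1 = 0)%N by nlia.
  have -> : (N.-1 - N.-2 = 1)%N by nlia.
  by rewrite /d !scaleNr opprD.
- by rewrite oppr_lt0.
- by rewrite oppr_lt0.
- by rewrite -(poly_set_ext E) set'.
Qed.

(** A single edge is a constant map, and two edges share their midpoint. *)
Lemma poly_emb_ge3 n v : poly_emb n v -> (2 < n)%N.
Proof.
move=> emb; have h0 : 0 <= (0 : RR) < 1 by rewrite lexx ltr01.
have h2 : 0 <= (2^-1 : RR) < 1 by lra.
case: n emb => [|[|[|//]]] emb; first by have := emb.1.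
- have E : poly_pieces 1 v 0%N 0 = poly_pieces 1 v 0%N (2^-1).
    by rewrite poly_pieces0 /poly_pieces -scalerDl subrK scale1r.
  by have [_] := emb.2.2.2 0%N 0%N _ _ isT isT h0 h2 E; clear; lra.
- have E : poly_pieces 2 v 0%N (2^-1) = poly_pieces 2 v 1%N (2^-1).
    by rewrite /poly_pieces /cyc_next /=; apply/rowP => k; rewrite !mxE; field.
  by have [] := emb.2.2.2 0%N 1%N _ _ isT isT h2 h2 E.
Qed.

(* For every nontrivial knot type [K] (represented by a knot S in R^3):
   whenever s[K] = n, sps[K] is defined and sps[K] <= s[K] - 2. *)
Theorem theorem3p3 (S : set pt) :
  is_knot S -> nontrivial_knot S ->
  forall n : nat, is_stick_index S n ->
  exists k : nat, is_sps S k /\ (k <= n - 2)%N.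
Proof.
move=> _ nontriv n [[v [emb eqv]] _].
have n3 := poly_emb_ge3 emb.
have n4 : (3 < n)%N.
  rewrite ltn_neqAle n3 andbT; apply/eqP => n3'; apply: nontriv; subst n.
  exact: knot_equiv_trans (knot_equiv_sym eqv) (poly3_round emb).
have rep : sps_rep S (n - 2).
  case: n emb eqv n3 n4 => // N emb eqv _ N2.
  have [w [h [emb1 eqv1 hpos]]] := poly_normalize emb.
  have [w' [emb2 eqv2 hpos' gen]] := poly_generic emb1 hpos.
  rewrite subn2; apply: (sps_of_generic _ emb2 gen hpos'); first by nlia.
  apply: knot_equiv_trans eqv; apply: knot_equiv_sym.
  exact: knot_equiv_trans eqv1 eqv2.
have ex : exists k, `[< sps_rep S k >] by exists (n - 2)%N; apply/asboolP.
case: (ex_minnP ex) => k /asboolP kS kmin.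
exists k; split; last by apply: kmin; apply/asboolP.
by split=> // j jS; apply: kmin; apply/asboolP.
Qed.
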